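(* Let $q\in\mathbb{C}$, $q\neq 0,\pm 1$, let $\mathfrak{z}$ be the center of $U_q(\mathfrak{sl}_2)$, and let $\zeta:\mathfrak{z}\to\delta(U_q(\mathfrak{k}))\subset U_q(\mathfrak{sl}_2)\otimes C(\mathfrak{p})$ be the algebra homomorphism $\zeta=\delta\circ\gamma$, where $\gamma:\mathfrak{z}\to U_q(\mathfrak{k})$ is the Harish-Chandra type homomorphism and $\delta$ the diagonal embedding. Then for any $z\in\mathfrak{z}$ there is a $U_q(\mathfrak{k})$-invariant element $a\in U_q(\mathfrak{sl}_2)\otimes C(\mathfrak{p})$ such that $$z\otimes 1=\zeta(z)+Da+aD,$$ where $D=E\otimes c(F_0)+F\otimes c(E_0)$ is the Dirac operator.
   Context: $U_q(\mathfrak{sl}_2)$ is the associative unital $\mathbb{C}$-algebra generated by $K,K^{-1},E,F$ with relations $KK^{-1}=K^{-1}K=1$, $KE=q^2EK$, $KF=q^{-2}FK$, $EF-FE=\frac{K-K^{-1}}{q-q^{-1}}$. The number $q$ may or may not be a root of unity. $C(\mathfrak{p})$ is the associative unital $\mathbb{C}$-algebra generated by $c(E_0),c(F_0)$ with relations $c(E_0)^2=0$, $c(F_0)^2=0$, $c(E_0)c(F_0)+c(F_0)c(E_0)=1$. The tensor product is the ordinary (ungraded) tensor product of algebras. $U_q(\mathfrak{k})=\mathbb{C}[K,K^{-1}]\subset U_q(\mathfrak{sl}_2)$. The algebra homomorphism $\alpha:U_q(\mathfrak{k})\to C(\mathfrak{p})$ is given by $\alpha(K)=q^{-1}+(q-q^{-1})c(E_0)c(F_0)$,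 $\alpha(K^{-1})=\alpha(K)^{-1}=q-(q-q^{-1})c(E_0)c(F_0)$. The diagonal embedding $\delta:U_q(\mathfrak{k})\to U_q(\mathfrak{sl}_2)\otimes C(\mathfrak{p})$ is the injective algebra homomorphism with $\delta(K^{\pm1})=K^{\pm1}\otimes\alpha(K^{\pm1})$. $U_q(\mathfrak{k})$ acts on $U_q(\mathfrak{sl}_2)\otimes C(\mathfrak{p})$ by letting $K^{\pm1}$ act by conjugation by $K^{\pm1}$ in the first factor and conjugation by $\alpha(K^{\pm1})$ in the second factor, i.e. by $x\mapsto \delta(K^{\pm1})\,x\,\delta(K^{\mp1})$; an element is $U_q(\mathfrak{k})$-invariant if it is fixed by the actions of $K$ and $K^{-1}$. The homomorphism $\gamma$: the monomials $E^iK^jF^k$ ($i,k\in\mathbb{N}_0$, $j\in\mathbb{Z}$) form a vector space basis of $U_q(\mathfrak{sl}_2)$, so $U_q(\mathfrak{sl}_2)=U_q(\mathfrak{k})\oplus(E\,U_q(\mathfrak{sl}_2)+U_q(\mathfrak{sl}_2)F)$. Let $\mu:U_q(\mathfrak{sl}_2)\to U_q(\mathfrak{k})$ be the projection along $E\,U_q(\mathfrak{sl}_2)+U_q(\mathfrak{sl}_2)F$; its restriction to $\mathfrak{z}$ is an algebra homomorphism. Let $\sigma:U_q(\mathfrak{k})\to U_q(\mathfrak{k})$ be the algebra automorphism with $\sigma(K^j)=q^jK^j$ for $j\in\mathbb{Z}$. Then $\gamma=\sigma\circ\mu|_{\mathfrak{z}}$. *)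

(* Defs.v *)
From HB Require Import structures.
From mathcomp Require Import all_boot all_order all_algebra.
From mathcomp Require Import boolp classical_sets.
From mathcomp Require Import ring.

Set Implicit Arguments.
Unset Strict Implicit.
Unset Printing Implicit Defensive.

Import Order.TTheory GRing.Theory Num.Theory.
Local Open Scope ring_scope.
Local Open Scope quotient_scope.

Inductive pterm (k G : Type) : Type :=
| Gen of G
| Scal of k
| Add of pterm k G & pterm k G
| Mul of pterm k G & pterm k G.

HB.instance Definition _ (k G : Type) := gen_eqMixin (pterm k G).
HB.instance Definition _ (k G : Type) := gen_choiceMixin (pterm k G).

Declare Scope pterm_scope.
Delimit Scope pterm_scope with PT.
Bind Scope pterm_scope with pterm.
Notation "c %:S" := (Scal _ c) (at level 2, left associativity,
  format "c %:S") : pterm_scope.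
Notation "s + t" := (Add s t) : pterm_scope.
Notation "s * t" := (Mul s t) : pterm_scope.
Notation "s - t" := (Add s (Mul (Scal _ (- 1)%R) t)) : pterm_scope.

Fixpoint eval (k : fieldType) (G : Type) (A : algType k) (f : G -> A)
    (t : pterm k G) : A :=
  match t with
  | Gen g => f g
  | Scal c => c%:A
  | Add s t => eval f s + eval f t
  | Mul s t => eval f s * eval f t
  end.

(* The least congruence for which terms form a unital associative k-algebra
   satisfying the relations rel. *)
Inductive pres_eq (k : fieldType) (G : Type)
    (rel : pterm k G -> pterm k G -> Prop) : pterm k G -> pterm k G -> Prop :=
| pres_rel s t : rel s t -> pres_eq rel s t
| pres_refl t : pres_eq rel t t
| pres_sym s t : pres_eq rel s t -> pres_eq rel t s
| pres_trans s t u : pres_eq rel s t -> pres_eq rel t u -> pres_eq rel s u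
| pres_add s s' t t' : pres_eq rel s s' -> pres_eq rel t t' ->
    pres_eq rel (s + t) (s' + t')
| pres_mul s s' t t' : pres_eq rel s s' -> pres_eq rel t t' ->
    pres_eq rel (s * t) (s' * t')
| pres_addA s t u : pres_eq rel (s + (t + u)) (s + t + u)
| pres_addC s t : pres_eq rel (s + t) (t + s)
| pres_add0 t : pres_eq rel (0%:S + t) t
| pres_mulA s t u : pres_eq rel (s * (t * u)) (s * t * u)
| pres_1mul t : pres_eq rel (1%:S * t) t
| pres_mul1 t : pres_eq rel (t * 1%:S) t
| pres_0mul t : pres_eq rel (0%:S * t) 0%:S
| pres_mulDl s t u : pres_eq rel ((s + t) * u) (s * u + t * u)
| pres_mulDr s t u : pres_eq rel (s * (t + u)) (s * t + s * u)
| pres_scalD c d : pres_eq rel (c + d)%R%:S (c%:S + d%:S)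
| pres_scalM c d : pres_eq rel (c * d)%R%:S (c%:S * d%:S)
| pres_scalC c t : pres_eq rel (c%:S * t) (t * c%:S).

(* MathComp's algType excludes the zero algebra. *)
Record presentation (k : fieldType) := Presentation {
  gen : Type;
  rels : pterm k gen -> pterm k gen -> Prop;
  pres_neq0 : ~ pres_eq rels 1%:S 0%:S
}.

Lemma eval_pres_eq (k : fieldType) (G : Type)
    (rel : pterm k G -> pterm k G -> Prop) (A : algType k) (f : G -> A) :
  (forall s t, rel s t -> eval f s = eval f t) ->
  forall s t, pres_eq rel s t -> eval f s = eval f t.
Proof.
move=> frel s t; elim=> {s t} //=.
- by move=> s t u _ -> _ ->.
- by move=> s s' t t' _ -> _ ->.
- by move=> s s' t t' _ -> _ ->.
- by move=> s t u; rewrite addrA.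
- by move=> s t; rewrite addrC.
- by move=> t; rewrite scale0r add0r.
- by move=> s t u; rewrite mulrA.
- by move=> t; rewrite scale1r mul1r.
- by move=> t; rewrite scale1r mulr1.
- by move=> t; rewrite scale0r mul0r.
- by move=> s t u; rewrite mulrDl.
- by move=> s t u; rewrite mulrDr.
- by move=> c d; rewrite scalerDl.
- by move=> c d; rewrite -scalerAl mul1r scalerA.
- by move=> c t; rewrite -scalerAl -scalerAr mul1r mulr1.
Qed.

Lemma pres_neq0_model (k : fieldType) (G : Type)
    (rel : pterm k G -> pterm k G -> Prop) (A : algType k) (f : G -> A) :
  (forall s t, rel s t -> eval f s = eval f t) -> ~ pres_eq rel 1%:S 0%:S.
Proof.
move=> frel /(eval_pres_eq frel) /= /eqP.
by rewrite scale1r scale0r oner_eq0.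
Qed.

Section PresentedAlgebra.
Variables (k : fieldType) (P : presentation k).
Local Notation T := (pterm k (gen P)).
Local Notation "s ~ t" := (pres_eq (@rels k P) s t) (at level 70).

Definition pres_eqb (s t : T) : bool := `[< s ~ t >].

Lemma pres_eqb_refl : reflexive pres_eqb.
Proof. by move=> t; apply/asboolP/pres_refl. Qed.

Lemma pres_eqb_sym : symmetric pres_eqb.
Proof. by move=> s t; apply/asboolP/asboolP; apply: pres_sym. Qed.

Lemma pres_eqb_trans : transitive pres_eqb.
Proof.
by move=> t s u /asboolP st /asboolP tu; apply/asboolP; apply: pres_trans st tu.
Qed.

Canonical pres_equiv :=
  EquivRel pres_eqb pres_eqb_refl pres_eqb_sym pres_eqb_trans.

Definition presalg : Type := {eq_quot pres_equiv}.
HB.instance Definition _ := Choice.on presalg.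
HB.instance Definition _ := Quotient.on presalg.

Definition pi_term (t : T) : presalg := \pi_presalg t.

Lemma pi_termP s t : pi_term s = pi_term t <-> s ~ t.
Proof.
split; first by move/eqmodP => /asboolP.
by move=> st; apply/eqmodP/asboolP.
Qed.

Lemma repr_pi_term t : repr (pi_term t) ~ t.
Proof. by apply/pi_termP; rewrite /pi_term reprK. Qed.

Lemma pi_termK (x : presalg) : pi_term (repr x) = x.
Proof. exact: reprK. Qed.

Definition padd (x y : presalg) := pi_term (repr x + repr y)%PT.
Definition pmul (x y : presalg) := pi_term (repr x * repr y)%PT.
Definition pscale (c : k) (x : presalg) := pi_term (c%:S * repr x)%PT.

Lemma padd_pi s t : padd (pi_term s) (pi_term t) = pi_term (s + t)%PT.
Proof. by apply/pi_termP; apply: pres_add; apply: repr_pi_term. Qed.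

Lemma pmul_pi s t : pmul (pi_term s) (pi_term t) = pi_term (s * t)%PT.
Proof. by apply/pi_termP; apply: pres_mul; apply: repr_pi_term. Qed.

Lemma pscale_pi c t : pscale c (pi_term t) = pi_term (c%:S * t)%PT.
Proof.
by apply/pi_termP; apply: pres_mul; [apply: pres_refl|apply: repr_pi_term].
Qed.

Lemma pi_term_ind (Q : presalg -> Prop) :
  (forall t, Q (pi_term t)) -> forall x, Q x.
Proof. by move=> Qpi x; rewrite -(pi_termK x). Qed.

Lemma paddA : associative padd.
Proof.
elim/pi_term_ind => s; elim/pi_term_ind => t; elim/pi_term_ind => u.
by rewrite !padd_pi; apply/pi_termP/pres_addA.
Qed.

Lemma paddC : commutative padd.
Proof.
elim/pi_term_ind => s; elim/pi_term_ind => t.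
by rewrite !padd_pi; apply/pi_termP/pres_addC.
Qed.

Lemma padd0 : left_id (pi_term 0%:S) padd.
Proof. by elim/pi_term_ind => s; rewrite !padd_pi; apply/pi_termP/pres_add0. Qed.

Lemma pscaleDl x c d : pscale (c + d) x = padd (pscale c x) (pscale d x).
Proof.
elim/pi_term_ind: x => t; rewrite !pscale_pi padd_pi; apply/pi_termP.
apply: pres_trans (pres_mulDl _ _ _ _).
by apply: pres_mul; [apply: pres_scalD|apply: pres_refl].
Qed.

Lemma pscale1 : left_id 1 pscale.
Proof. by elim/pi_term_ind => t; rewrite pscale_pi; apply/pi_termP/pres_1mul. Qed.

Lemma paddN : left_inverse (pi_term 0%:S) (pscale (- 1)) padd.
Proof.
move=> x; rewrite -{2}(pscale1 x) -pscaleDl addNr.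
by elim/pi_term_ind: x => t; rewrite pscale_pi; apply/pi_termP/pres_0mul.
Qed.

HB.instance Definition _ :=
  GRing.isZmodule.Build presalg paddA paddC padd0 paddN.

Lemma pmulA : associative pmul.
Proof.
elim/pi_term_ind => s; elim/pi_term_ind => t; elim/pi_term_ind => u.
by rewrite !pmul_pi; apply/pi_termP/pres_mulA.
Qed.

Lemma p1mul : left_id (pi_term 1%:S) pmul.
Proof. by elim/pi_term_ind => s; rewrite !pmul_pi; apply/pi_termP/pres_1mul. Qed.

Lemma pmul1 : right_id (pi_term 1%:S) pmul.
Proof. by elim/pi_term_ind => s; rewrite !pmul_pi; apply/pi_termP/pres_mul1. Qed.

Lemma pmulDl : left_distributive pmul +%R.
Proof.
elim/pi_term_ind => s; elim/pi_term_ind => t; elim/pi_term_ind => u.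
by rewrite /+%R /= !(padd_pi, pmul_pi); apply/pi_termP/pres_mulDl.
Qed.

Lemma pmulDr : right_distributive pmul +%R.
Proof.
elim/pi_term_ind => s; elim/pi_term_ind => t; elim/pi_term_ind => u.
by rewrite /+%R /= !(padd_pi, pmul_pi); apply/pi_termP/pres_mulDr.
Qed.

Lemma p1neq0 : pi_term 1%:S != 0 :> presalg.
Proof. by apply/eqP => /pi_termP; apply: pres_neq0. Qed.

HB.instance Definition _ := GRing.Zmodule_isNzRing.Build presalg
  pmulA p1mul pmul1 pmulDl pmulDr p1neq0.

Lemma pscaleA c d x : pscale c (pscale d x) = pscale (c * d) x.
Proof.
elim/pi_term_ind: x => t; rewrite !pscale_pi; apply/pi_termP.
apply: pres_trans (pres_mulA _ _ _ _) _.
by apply: pres_mul; [apply/pres_sym/pres_scalM|apply: pres_refl].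
Qed.

Lemma pscaleDr : right_distributive pscale +%R.
Proof.
move=> c; elim/pi_term_ind => s; elim/pi_term_ind => t.
by rewrite /+%R /= !(padd_pi, pscale_pi); apply/pi_termP/pres_mulDr.
Qed.

HB.instance Definition _ := GRing.Zmodule_isLmodule.Build k presalg
  pscaleA pscale1 pscaleDr pscaleDl.

Lemma pscaleAl c (x y : presalg) : c *: (x * y) = (c *: x) * y.
Proof.
elim/pi_term_ind: x => s; elim/pi_term_ind: y => t.
rewrite /( *:%R ) /( *%R ) /= !(pmul_pi, pscale_pi).
by apply/pi_termP/pres_mulA.
Qed.

HB.instance Definition _ := GRing.Lmodule_isLalgebra.Build k presalg pscaleAl.

Lemma pscaleAr c (x y : presalg) : c *: (x * y) = x * (c *: y).
Proof.
elim/pi_term_ind: x => s; elim/pi_term_ind: y => t.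
rewrite /( *:%R ) /( *%R ) /= !(pmul_pi, pscale_pi); apply/pi_termP.
apply: pres_trans (pres_mulA _ _ _ _) _.
apply: pres_trans (pres_sym (pres_mulA _ _ _ _)).
by apply: pres_mul; [apply: pres_scalC|apply: pres_refl].
Qed.

HB.instance Definition _ := GRing.Lalgebra_isAlgebra.Build k presalg pscaleAr.

Lemma pi_termD s t : pi_term (s + t)%PT = pi_term s + pi_term t.
Proof. by rewrite /+%R /= padd_pi. Qed.

Lemma pi_termM s t : pi_term (s * t)%PT = pi_term s * pi_term t.
Proof. by rewrite /( *%R ) /= pmul_pi. Qed.

Lemma pi_termZ c t : pi_term (c%:S * t)%PT = c *: pi_term t.
Proof. by rewrite /( *:%R ) /= pscale_pi. Qed.

Lemma pi_termS c : pi_term c%:S = c%:A.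
Proof. by rewrite -[1]/(pi_term _) -pi_termZ; apply/pi_termP/pres_sym/pres_mul1. Qed.

Definition pgen (g : gen P) : presalg := pi_term (Gen k g).

Lemma presalg_ind (Q : presalg -> Prop) :
  (forall g, Q (pgen g)) -> (forall c, Q c%:A) ->
  (forall x y, Q x -> Q y -> Q (x + y)) ->
  (forall x y, Q x -> Q y -> Q (x * y)) -> forall x, Q x.
Proof.
move=> Qg Qs Qa Qm; elim/pi_term_ind; elim=> [g|c|s Qs1 t Qt|s Qs1 t Qt].
- exact: Qg.
- by rewrite pi_termS.
- by rewrite pi_termD; apply: Qa.
- by rewrite pi_termM; apply: Qm.
Qed.

Lemma pgen_rel s t : rels s t -> eval pgen s = eval pgen t.
Proof.
have ev u : eval pgen u = pi_term u.
  elim: u => [g|c|u IHu v IHv|u IHu v IHv] //=; first by rewrite pi_termS.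
    by rewrite IHu IHv pi_termD.
  by rewrite IHu IHv pi_termM.
by move=> st; rewrite !ev; apply/pi_termP/pres_rel.
Qed.

(* The algebra homomorphism with pgen g |-> f g, provided that f satisfies
   the relations of P. *)
Definition lift (A : algType k) (f : gen P -> A) (x : presalg) : A :=
  eval f (repr x).

Section Lift.
Variables (A : algType k) (f : gen P -> A).
Hypothesis f_rels : forall s t, rels s t -> eval f s = eval f t.

Lemma lift_pi t : lift f (pi_term t) = eval f t.
Proof. exact/(eval_pres_eq f_rels)/repr_pi_term. Qed.

Lemma lift_gen g : lift f (pgen g) = f g.
Proof. exact: lift_pi. Qed.

Lemma lift_scal c : lift f c%:A = c%:A.
Proof. by rewrite -pi_termS lift_pi. Qed.

Lemma liftD : {morph lift f : x y / x + y}.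
Proof.
elim/pi_term_ind => s; elim/pi_term_ind => t.
by rewrite -pi_termD !lift_pi.
Qed.

Lemma liftM : {morph lift f : x y / x * y}.
Proof.
elim/pi_term_ind => s; elim/pi_term_ind => t.
by rewrite -pi_termM !lift_pi.
Qed.

Lemma liftZ c : {morph lift f : x / c *: x}.
Proof. by move=> x; rewrite -mulr_algl liftM lift_scal mulr_algl. Qed.

Lemma lift1 : lift f 1 = 1.
Proof. by rewrite -[1](scale1r 1) lift_scal scale1r. Qed.

End Lift.
End PresentedAlgebra.

(* Finite formal sums of pure tensors, represented by lists of pairs, modulo
   the least additive congruence making (a, b) bilinear. *)
Inductive tensor_eq (k : fieldType) (A B : algType k) :
    seq (A * B) -> seq (A * B) -> Prop :=
| tensor_refl s : tensor_eq s s
| tensor_sym s t : tensor_eq s t -> tensor_eq t s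
| tensor_trans s t u : tensor_eq s t -> tensor_eq t u -> tensor_eq s u
| tensor_cat s s' t t' : tensor_eq s s' -> tensor_eq t t' ->
    tensor_eq (s ++ t) (s' ++ t')
| tensor_catC s t : tensor_eq (s ++ t) (t ++ s)
| tensor_Dl a a' b : tensor_eq [:: (a + a', b)] [:: (a, b); (a', b)]
| tensor_Dr a b b' : tensor_eq [:: (a, b + b')] [:: (a, b); (a, b')]
| tensor_Z c a b : tensor_eq [:: (c *: a, b)] [:: (a, c *: b)]
| tensor_0 b : tensor_eq [:: (0, b)] [::].

(* Only used to see that the tensor product is not the zero algebra. *)
Lemma ex_functional (k : fieldType) (A : algType k) :
  exists phi : A -> k,
    [/\ {morph phi : x y / x + y}, forall c, {morph phi : x / c *: x >-> c * x}
      & phi 1 = 1].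
Proof.
pose Q (S : set A) := (forall c x y, S x -> S y -> S (c *: x + y)) /\ ~ S 1.
have [W [[Wlin W1] Wmax]] : exists W, Q W /\ forall B, (W `<` B)%classic -> ~ Q B.
  apply: Zorn_bigcup => F FQ Ftot; split=> [c x y [S FS Sx] [S' FS' S'y]|].
    have [SS'|S'S] := Ftot _ _ FS FS'.
      by exists S' => //; apply: (FQ _ FS').1 => //; apply: SS'.
    by exists S => //; apply: (FQ _ FS).1 => //; apply: S'S.
  by move=> [S FS]; apply: (FQ _ FS).2.
have W0 : W 0.
  apply: contrapT => nW0.
  have nW x : ~ W x.
    by move=> Wx; apply: nW0; rewrite -(addNr x) -scaleN1r; apply: Wlin.
  apply: (Wmax [set 0%R]%classic).
    by split=> [x /nW //|]; move/(_ 0 erefl).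
  split=> [c x y -> ->|]; first by rewrite /= scaler0 addr0.
  by move=> /= /eqP; rewrite oner_eq0.
have WZ c x : W x -> W (c *: x) by move=> Wx; rewrite -[_ *: _]addr0; apply: Wlin.
have WD x y : W x -> W y -> W (x + y).
  by move=> Wx Wy; rewrite -[x]scale1r; apply: Wlin.
have ex a : exists c : k, W (a - c%:A).
  apply: contrapT => nex.
  pose W' := [set x | exists w d, W w /\ x = w + d *: a]%classic.
  apply: (Wmax W').
    split=> [x Wx|WW']; first by exists x, 0; rewrite scale0r addr0.
    apply: nex; exists 0; rewrite scale0r subr0; apply: WW'.
    by exists 0, 1; rewrite add0r scale1r.
  split=> [c x y [w [d [Ww ->]]] [w' [d' [Ww' ->]]]|].
    exists (c *: w + w'), (c * d + d'); split; first exact: Wlin.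
    by rewrite scalerDr scalerDl scalerA addrACA.
  move=> [w [d [Ww e1]]].
  have d0 : d != 0.
    by apply/eqP => d0; apply: W1; rewrite e1 d0 scale0r addr0.
  apply: nex; exists d^-1; have -> : a - d^-1%:A = - d^-1 *: w; last exact: WZ.
  by rewrite e1 scalerDr scalerA mulVf // scale1r opprD addrCA subrr addr0 scaleNr.
have uniq a c c' : W (a - c%:A) -> W (a - c'%:A) -> c = c'.
  move=> Wc Wc'; apply/eqP; rewrite -subr_eq0; apply/negPn/negP => cc'.
  apply: W1; rewrite -(scale1r 1) -(mulVf cc') -scalerA; apply: (WZ).
  have -> : (c - c')%:A = (a - c'%:A) + -1 *: (a - c%:A).
    by rewrite scaleN1r opprB [RHS]addrC subrKA scalerBl.
  by apply: WD => //; apply: WZ.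
exists (fun a => projT1 (cid (ex a))); split=> [x y|c x|].
- case: cid => cxy /= Wxy; case: cid => cx /= Wx; case: cid => cy /= Wy.
  by apply: uniq Wxy _; rewrite scalerDl opprD addrACA; apply: WD.
- case: cid => cx /= Wx; case: cid => cy /= Wy.
  by apply: uniq Wx _; rewrite -scalerA -scalerBr; apply: WZ.
- by case: cid => c /= Wc; apply: uniq Wc _; rewrite scale1r subrr.
Qed.

Section Tensor.
Variables (k : fieldType) (A B : algType k).
Local Notation T := (seq (A * B)).

Definition tensor_eqb (s t : T) : bool := `[< tensor_eq s t >].

Lemma tensor_eqb_refl : reflexive tensor_eqb.
Proof. by move=> t; apply/asboolP/tensor_refl. Qed.

Lemma tensor_eqb_sym : symmetric tensor_eqb.
Proof. by move=> s t; apply/asboolP/asboolP; apply: tensor_sym. Qed.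

Lemma tensor_eqb_trans : transitive tensor_eqb.
Proof.
by move=> t s u /asboolP st /asboolP tu; apply/asboolP; apply: tensor_trans st tu.
Qed.

Canonical tensor_equiv :=
  EquivRel tensor_eqb tensor_eqb_refl tensor_eqb_sym tensor_eqb_trans.

Definition tensor : Type := {eq_quot tensor_equiv}.
HB.instance Definition _ := Choice.on tensor.
HB.instance Definition _ := Quotient.on tensor.

Definition pi_tensor (s : T) : tensor := \pi_tensor s.

Lemma pi_tensorP s t : pi_tensor s = pi_tensor t <-> tensor_eq s t.
Proof.
split; first by move/eqmodP => /asboolP.
by move=> st; apply/eqmodP/asboolP.
Qed.

Lemma pi_tensorK (x : tensor) : pi_tensor (repr x) = x.
Proof. exact: reprK. Qed.

Lemma repr_pi_tensor t : tensor_eq (repr (pi_tensor t)) t.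
Proof. by apply/pi_tensorP; rewrite pi_tensorK. Qed.

Lemma pi_tensor_ind (Q : tensor -> Prop) :
  (forall t, Q (pi_tensor t)) -> forall x, Q x.
Proof. by move=> Qpi x; rewrite -(pi_tensorK x). Qed.

Definition tadd (x y : tensor) := pi_tensor (repr x ++ repr y).
Definition topp (x : tensor) := pi_tensor [seq (- s.1, s.2) | s <- repr x].

Lemma tadd_pi s t : tadd (pi_tensor s) (pi_tensor t) = pi_tensor (s ++ t).
Proof. by apply/pi_tensorP; apply: tensor_cat; apply: repr_pi_tensor. Qed.

Lemma taddA : associative tadd.
Proof.
elim/pi_tensor_ind => s; elim/pi_tensor_ind => t; elim/pi_tensor_ind => u.
by rewrite !tadd_pi catA.
Qed.

Lemma taddC : commutative tadd.
Proof.
elim/pi_tensor_ind => s; elim/pi_tensor_ind => t.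
by rewrite !tadd_pi; apply/pi_tensorP/tensor_catC.
Qed.

Lemma tadd0 : left_id (pi_tensor [::]) tadd.
Proof. by elim/pi_tensor_ind => s; rewrite tadd_pi. Qed.

Lemma taddN : left_inverse (pi_tensor [::]) topp tadd.
Proof.
move=> x; rewrite -{2}(pi_tensorK x) /topp; move: (repr x) => s {x}.
rewrite tadd_pi; apply/pi_tensorP; elim: s => [|[a b] s IHs] /=.
  exact: tensor_refl.
apply: (@tensor_trans _ _ _ _
  ([:: (- a, b); (a, b)] ++ ([seq (- x.1, x.2) | x <- s] ++ s))).
  rewrite -cat1s -[_ :: s]cat1s -[[:: (- a, b); _]]/([:: _] ++ [:: _]) -catA.
  apply: tensor_cat; first exact: tensor_refl.
  rewrite !catA; apply: tensor_cat; last exact: tensor_refl.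
  exact: tensor_catC.
rewrite -[X in tensor_eq _ X]cats0; apply: tensor_cat => //.
apply: tensor_trans (tensor_0 A b).
by rewrite -(addNr a); apply/tensor_sym/tensor_Dl.
Qed.

HB.instance Definition _ :=
  GRing.isZmodule.Build tensor taddA taddC tadd0 taddN.

Definition tens (a : A) (b : B) : tensor := pi_tensor [:: (a, b)].
Local Notation "a \ox b" := (tens a b) (at level 40, left associativity).

Lemma pi_tensor_cat s t : pi_tensor (s ++ t) = pi_tensor s + pi_tensor t.
Proof. by rewrite /+%R /= tadd_pi. Qed.

Lemma pi_tensorE s : pi_tensor s = \sum_(x <- s) x.1 \ox x.2.
Proof.
elim: s => [|[a b] s IHs]; first by rewrite big_nil.
by rewrite big_cons -IHs -cat1s pi_tensor_cat.
Qed.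

Lemma tensE (x : tensor) : x = \sum_(s <- repr x) s.1 \ox s.2.
Proof. by rewrite -pi_tensorE pi_tensorK. Qed.

Lemma tensor_ind (Q : tensor -> Prop) :
  Q 0 -> (forall a b, Q (a \ox b)) -> (forall x y, Q x -> Q y -> Q (x + y)) ->
  forall x, Q x.
Proof.
move=> Q0 Qt Qa x; rewrite (tensE x); elim: (repr x) => [|[a b] s IHs].
  by rewrite big_nil.
by rewrite big_cons; apply: Qa.
Qed.

Lemma tensDl a a' b : (a + a') \ox b = a \ox b + a' \ox b.
Proof. by rewrite -pi_tensor_cat; apply/pi_tensorP/tensor_Dl. Qed.

Lemma tensDr a b b' : a \ox (b + b') = a \ox b + a \ox b'.
Proof. by rewrite -pi_tensor_cat; apply/pi_tensorP/tensor_Dr. Qed.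

Lemma tensZ c a b : (c *: a) \ox b = a \ox (c *: b).
Proof. by apply/pi_tensorP/tensor_Z. Qed.

Lemma tens0l b : 0 \ox b = 0.
Proof. by apply/pi_tensorP/tensor_0. Qed.

Section Bilinear.
Variables (V : zmodType) (f : A -> B -> V).
Hypotheses (fDl : forall a a' b, f (a + a') b = f a b + f a' b)
  (fDr : forall a b b', f a (b + b') = f a b + f a b')
  (fZ : forall c a b, f (c *: a) b = f a (c *: b)).

Lemma sum_tensor_eq s t : tensor_eq s t ->
  \sum_(x <- s) f x.1 x.2 = \sum_(x <- t) f x.1 x.2.
Proof.
elim=> {s t} //=.
- by move=> s t u _ -> _ ->.
- by move=> s s' t t' _ e _ e'; rewrite !big_cat /= e e'.
- by move=> s t; rewrite !big_cat /= addrC.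
- by move=> a a' b; rewrite !(big_cons, big_nil) /= fDl !addr0.
- by move=> a b b'; rewrite !(big_cons, big_nil) /= fDr !addr0.
- by move=> c a b; rewrite !(big_cons, big_nil) /= fZ.
- move=> b; rewrite !(big_cons, big_nil) /= addr0.
  by apply: (@addrI _ (f 0 b)); rewrite -fDl !addr0.
Qed.

Definition tlift (x : tensor) : V := \sum_(s <- repr x) f s.1 s.2.

Lemma tlift_pi s : tlift (pi_tensor s) = \sum_(x <- s) f x.1 x.2.
Proof. exact/sum_tensor_eq/repr_pi_tensor. Qed.

Lemma tlift_tens a b : tlift (a \ox b) = f a b.
Proof. by rewrite tlift_pi big_seq1. Qed.

Lemma tlift0 : tlift 0 = 0.
Proof. by rewrite -[0]/(pi_tensor [::]) tlift_pi big_nil. Qed.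

Lemma tliftD : {morph tlift : x y / x + y}.
Proof.
elim/pi_tensor_ind => s; elim/pi_tensor_ind => t.
by rewrite -pi_tensor_cat !tlift_pi big_cat.
Qed.

End Bilinear.

Definition tmul (x y : tensor) : tensor :=
  \sum_(s <- repr x) \sum_(t <- repr y) (s.1 * t.1) \ox (s.2 * t.2).
Definition tscale (c : k) (x : tensor) : tensor :=
  \sum_(s <- repr x) (c *: s.1) \ox s.2.

Lemma tscale_tens c a b : tscale c (a \ox b) = (c *: a) \ox b.
Proof.
apply: (tlift_tens (f := fun a b => (c *: a) \ox b)) => *.
- by rewrite scalerDr tensDl.
- by rewrite tensDr.
- by rewrite scalerA mulrC -scalerA tensZ.
Qed.

Lemma tscaleDr : right_distributive tscale +%R.
Proof.
move=> c; apply: (tliftD (f := fun a b => (c *: a) \ox b)) => *.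
- by rewrite scalerDr tensDl.
- by rewrite tensDr.
- by rewrite scalerA mulrC -scalerA tensZ.
Qed.

Lemma tscale0 c : tscale c 0 = 0.
Proof. by apply: (addrI (tscale c 0)); rewrite -tscaleDr !addr0. Qed.

Lemma tscaleA c d x : tscale c (tscale d x) = tscale (c * d) x.
Proof.
elim/tensor_ind: x => [|a b|x y IHx IHy]; first by rewrite !tscale0.
  by rewrite !tscale_tens scalerA.
by rewrite !tscaleDr IHx IHy.
Qed.

Lemma tscale1 : left_id 1 tscale.
Proof.
elim/tensor_ind => [|a b|x y IHx IHy]; first by rewrite !tscale0.
  by rewrite !tscale_tens scale1r.
by rewrite !tscaleDr IHx IHy.
Qed.

Lemma tscaleDl x : {morph tscale^~ x : c d / c + d}.
Proof.
move=> c d; elim/tensor_ind: x => [|a b|x y IHx IHy].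
- by rewrite !tscale0 addr0.
- by rewrite !tscale_tens scalerDl tensDl.
- by rewrite !tscaleDr IHx IHy addrACA.
Qed.

HB.instance Definition _ := GRing.Zmodule_isLmodule.Build k tensor
  tscaleA tscale1 tscaleDr tscaleDl.

Lemma tensZl c a b : (c *: a) \ox b = c *: (a \ox b).
Proof. by rewrite -tscale_tens. Qed.

Lemma tensZr c a b : a \ox (c *: b) = c *: (a \ox b).
Proof. by rewrite -tensZ tensZl. Qed.

Let inner (y : tensor) a b := tlift (fun a' b' => (a * a') \ox (b * b')) y.

Let inner_tens a b a' b' : inner (a' \ox b') a b = (a * a') \ox (b * b').
Proof.
apply: (tlift_tens (f := fun a' b' => (a * a') \ox (b * b'))) => *.
- by rewrite mulrDr tensDl.
- by rewrite mulrDr tensDr.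
- by rewrite -!scalerAr tensZ.
Qed.

Let innerD a b : {morph (fun y => inner y a b) : x y / x + y}.
Proof.
apply: (tliftD (f := fun a' b' => (a * a') \ox (b * b'))) => *.
- by rewrite mulrDr tensDl.
- by rewrite mulrDr tensDr.
- by rewrite -!scalerAr tensZ.
Qed.

Let inner_Dl y a a' b : inner y (a + a') b = inner y a b + inner y a' b.
Proof. by rewrite -big_split /=; apply: eq_bigr => *; rewrite mulrDl tensDl. Qed.

Let inner_Dr y a b b' : inner y a (b + b') = inner y a b + inner y a b'.
Proof. by rewrite -big_split /=; apply: eq_bigr => *; rewrite mulrDl tensDr. Qed.

Let inner_Z y c a b : inner y (c *: a) b = inner y a (c *: b).
Proof. by apply: eq_bigr => *; rewrite -!scalerAl tensZ. Qed.

Lemma tmulDl : left_distributive tmul +%R.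
Proof.
move=> x x' y.
exact: (tliftD (@inner_Dl y) (@inner_Dr y) (@inner_Z y)).
Qed.

Lemma tmulDr : right_distributive tmul +%R.
Proof.
move=> x y y'; rewrite /tmul -big_split /=; apply: eq_bigr => s _.
exact: innerD.
Qed.

Lemma tmul_tens a b a' b' :
  tmul (a \ox b) (a' \ox b') = (a * a') \ox (b * b').
Proof.
rewrite -inner_tens.
exact: (tlift_tens (@inner_Dl _) (@inner_Dr _) (@inner_Z _)).
Qed.

Lemma t0mul x : tmul 0 x = 0.
Proof. by apply: (addrI (tmul 0 x)); rewrite -tmulDl !addr0. Qed.

Lemma tmul0 x : tmul x 0 = 0.
Proof. by apply: (addrI (tmul x 0)); rewrite -tmulDr !addr0. Qed.

Lemma tmulA : associative tmul.
Proof.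
elim/tensor_ind => [|a b|x x' IHx IHx'] y z; first by rewrite !t0mul.
  elim/tensor_ind: y => [|a' b'|y y' IHy IHy'].
  - by rewrite !(t0mul, tmul0).
  - elim/tensor_ind: z => [|a'' b''|z z' IHz IHz'].
    + by rewrite !tmul0.
    + by rewrite !tmul_tens !mulrA.
    + by rewrite !tmulDr IHz IHz'.
  - by rewrite !(tmulDr, tmulDl) IHy IHy'.
by rewrite !tmulDl IHx IHx'.
Qed.

Lemma t1mul : left_id (1 \ox 1) tmul.
Proof.
elim/tensor_ind => [|a b|x y IHx IHy]; first by rewrite tmul0.
  by rewrite tmul_tens !mul1r.
by rewrite tmulDr IHx IHy.
Qed.

Lemma tmul1 : right_id (1 \ox 1) tmul.
Proof.
elim/tensor_ind => [|a b|x y IHx IHy]; first by rewrite t0mul.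
  by rewrite tmul_tens !mulr1.
by rewrite tmulDl IHx IHy.
Qed.

Lemma t1neq0 : 1 \ox 1 != 0.
Proof.
have [phi [phiD phiZ phi1]] := ex_functional A.
apply/eqP => /(congr1 (tlift (fun a b => phi a *: b))).
rewrite tlift0 ?tlift_tens.
- by move/eqP; rewrite phi1 scale1r oner_eq0.
- by move=> *; rewrite phiD scalerDl.
- by move=> *; rewrite scalerDr.
- by move=> *; rewrite phiZ scalerA mulrC.
- by move=> *; rewrite phiD scalerDl.
- by move=> *; rewrite scalerDr.
- by move=> *; rewrite phiZ scalerA mulrC.
Qed.

HB.instance Definition _ := GRing.Zmodule_isNzRing.Build tensor
  tmulA t1mul tmul1 tmulDl tmulDr t1neq0.

Lemma tens11 : 1 \ox 1 = 1 :> tensor. Proof. by []. Qed.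

Lemma tensM a b a' b' : (a \ox b) * (a' \ox b') = (a * a') \ox (b * b').
Proof. exact: tmul_tens. Qed.

Lemma tscaleAl c (x y : tensor) : c *: (x * y) = (c *: x) * y.
Proof.
elim/tensor_ind: x => [|a b|x x' IHx IHx'].
- by rewrite !(mul0r, scaler0).
- elim/tensor_ind: y => [|a' b'|y y' IHy IHy'].
  + by rewrite !(mulr0, scaler0).
  + by rewrite -!tensZl !tensM -scalerAl tensZl.
  + by rewrite !mulrDr scalerDr IHy IHy'.
- by rewrite !(mulrDl, scalerDr) IHx IHx'.
Qed.

HB.instance Definition _ := GRing.Lmodule_isLalgebra.Build k tensor tscaleAl.

Lemma tscaleAr c (x y : tensor) : c *: (x * y) = x * (c *: y).
Proof.
elim/tensor_ind: x => [|a b|x x' IHx IHx'].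
- by rewrite !(mul0r, scaler0).
- elim/tensor_ind: y => [|a' b'|y y' IHy IHy'].
  + by rewrite !(mulr0, scaler0).
  + by rewrite -!tensZl !tensM -scalerAr tensZl.
  + by rewrite !(mulrDr, scalerDr) IHy IHy'.
- by rewrite !(mulrDl, scalerDr) IHx IHx'.
Qed.

HB.instance Definition _ := GRing.Lalgebra_isAlgebra.Build k tensor tscaleAr.

End Tensor.

Notation "a \ox b" := (tens a b) (at level 40, left associativity) : ring_scope.

Variant Uk_gen := UkK | UkK'.
Variant Uq_gen := UqK | UqK' | UqE | UqF.
Variant Cl_gen := ClE | ClF.

Section Presentations.
Variables (k : fieldType) (q : k).
Local Open Scope pterm_scope.

Local Notation kK := (Gen k UkK).
Local Notation kK' := (Gen k UkK').

Variant Uk_rel : pterm k Uk_gen -> pterm k Uk_gen -> Prop :=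
| Uk_KK' : Uk_rel (kK * kK') 1%:S
| Uk_K'K : Uk_rel (kK' * kK) 1%:S.

Lemma Uk_neq0 : ~ pres_eq Uk_rel 1%:S 0%:S.
Proof.
apply: (@pres_neq0_model k _ _ k^o (fun=> 1%R)).
by move=> s t [] /=; rewrite mulr1 scale1r.
Qed.

Definition Uk_pres : presentation k := Presentation Uk_neq0.

Local Notation gK := (Gen k UqK).
Local Notation gK' := (Gen k UqK').
Local Notation gE := (Gen k UqE).
Local Notation gF := (Gen k UqF).

Variant Uq_rel : pterm k Uq_gen -> pterm k Uq_gen -> Prop :=
| Uq_KK' : Uq_rel (gK * gK') 1%:S
| Uq_K'K : Uq_rel (gK' * gK) 1%:S
| Uq_KE : Uq_rel (gK * gE) ((q ^+ 2)%:S * (gE * gK))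
| Uq_KF : Uq_rel (gK * gF) ((q ^- 2)%:S * (gF * gK))
| Uq_EF : Uq_rel (gE * gF - gF * gE) (((q - q^-1)^-1)%R%:S * (gK - gK')).

Lemma Uq_neq0 : ~ pres_eq Uq_rel 1%:S 0%:S.
Proof.
pose f g : k^o := if g is (UqK | UqK') then 1%R else 0%R.
apply: (@pres_neq0_model k _ _ k^o f).
by move=> s t [] /=; rewrite ?(mulr1, mulr0, scale1r, addr0, scaleN1r, subrr, mulN1r).
Qed.

Definition Uq_pres : presentation k := Presentation Uq_neq0.

Local Notation gcE := (Gen k ClE).
Local Notation gcF := (Gen k ClF).

Variant Cl_rel : pterm k Cl_gen -> pterm k Cl_gen -> Prop :=
| Cl_EE : Cl_rel (gcE * gcE) 0%:S
| Cl_FF : Cl_rel (gcF * gcF) 0%:S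
| Cl_EF : Cl_rel (gcE * gcF + gcF * gcE) 1%:S.

Lemma Cl_neq0 : ~ pres_eq Cl_rel 1%:S 0%:S.
Proof.
pose f g : 'M[k]_2 := if g is ClE then delta_mx 0 1 else delta_mx 1 0.
apply: (@pres_neq0_model k _ _ ('M[k]_2) f).
move=> s t [] /=; rewrite ?scale0r ?scale1r.
- by rewrite -mulmxE mul_delta_mx_cond.
- by rewrite -mulmxE mul_delta_mx_cond.
- rewrite -mulmxE !mul_delta_mx_cond /= !mulr1n.
  apply/matrixP => i j; rewrite !mxE.
  by case: i j => [[|[|?]] ?] [[|[|?]] ?] //=; rewrite ?addr0 ?add0r.
Qed.

Definition Cl_pres : presentation k := Presentation Cl_neq0.

End Presentations.

Notation Uk k := (presalg (Uk_pres k)).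
Notation Uq q := (presalg (Uq_pres q)).
Notation Cl k := (presalg (Cl_pres k)).
Notation UqCl q := (tensor (Uq q) (Cl _)).

Section HarishChandra.
Variables (k : fieldType) (q : k).

Definition K0 : Uk k := pgen (P := Uk_pres k) UkK.
Definition K0' : Uk k := pgen (P := Uk_pres k) UkK'.

Definition K : Uq q := pgen (P := Uq_pres q) UqK.
Definition K' : Uq q := pgen (P := Uq_pres q) UqK'.
Definition E : Uq q := pgen (P := Uq_pres q) UqE.
Definition F : Uq q := pgen (P := Uq_pres q) UqF.

Definition cE : Cl k := pgen (P := Cl_pres k) ClE.
Definition cF : Cl k := pgen (P := Cl_pres k) ClF.

(* The homomorphism with K |-> a and K^-1 |-> a', provided that a and a' are
   mutually inverse. *)
Definition Uk_lift (A : algType k) (a a' : A) : Uk k -> A :=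
  lift (P := Uk_pres k) (fun g => match g with UkK => a | UkK' => a' end).

(* The inclusion of C[K, K^-1] in U_q(sl_2), injective by iota_inj. *)
Definition iota : Uk k -> Uq q := Uk_lift K K'.

Definition alpha : Uk k -> Cl k :=
  Uk_lift (q^-1%:A + (q - q^-1) *: (cE * cF)) (q%:A - (q - q^-1) *: (cE * cF)).

Definition delta : Uk k -> UqCl q :=
  Uk_lift (K \ox alpha K0) (K' \ox alpha K0').

Definition sigma : Uk k -> Uk k := Uk_lift (q *: K0) (q^-1 *: K0').

(* The projection to C[K, K^-1] along E U + U F: by muP and mu_eq the set below
   is a singleton whenever q != 0, so the default value 0 is not used. *)
Definition mu (u : Uq q) : Uk k :=
  xget 0 [set h : Uk k | exists x y, u = iota h + E * x + y * F]%classic.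

Definition central (z : Uq q) : Prop := forall u : Uq q, z * u = u * z.

(* gamma and zeta are only considered on central elements. *)
Definition gamma (z : Uq q) : Uk k := sigma (mu z).
Definition zeta (z : Uq q) : UqCl q := delta (gamma z).

Definition Uk_invariant (a : UqCl q) : Prop :=
  delta K0 * a * delta K0' = a /\ delta K0' * a * delta K0 = a.

Definition dirac : UqCl q := E \ox cF + F \ox cE.

End HarishChandra.

Section Relations.
Variables (k : fieldType) (q : k).
Local Notation K := (K q).
Local Notation K' := (K' q).
Local Notation E := (E q).
Local Notation F := (F q).
Local Notation K0 := (K0 k).
Local Notation K0' := (K0' k).
Local Notation cE := (cE k).
Local Notation cF := (cF k).

Lemma K0K0' : K0 * K0' = 1.
Proof. by have /= := pgen_rel (P := Uk_pres k) (Uk_KK' k); rewrite scale1r. Qed.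

Lemma K0'K0 : K0' * K0 = 1.
Proof. by have /= := pgen_rel (P := Uk_pres k) (Uk_K'K k); rewrite scale1r. Qed.

Lemma KK' : K * K' = 1.
Proof. by have /= := pgen_rel (P := Uq_pres q) (Uq_KK' q); rewrite scale1r. Qed.

Lemma K'K : K' * K = 1.
Proof. by have /= := pgen_rel (P := Uq_pres q) (Uq_K'K q); rewrite scale1r. Qed.

Lemma KE : K * E = q ^+ 2 *: (E * K).
Proof.
by have /= := pgen_rel (P := Uq_pres q) (Uq_KE q); rewrite -scalerAl mul1r.
Qed.

Lemma KF : K * F = q ^- 2 *: (F * K).
Proof.
by have /= := pgen_rel (P := Uq_pres q) (Uq_KF q); rewrite -scalerAl mul1r.
Qed.

Lemma EF : E * F - F * E = (q - q^-1)^-1 *: (K - K').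
Proof.
have /= := pgen_rel (P := Uq_pres q) (Uq_EF q).
by rewrite -!scalerAl !mul1r !scaleN1r.
Qed.

Lemma cEE : cE * cE = 0.
Proof. by have /= := pgen_rel (P := Cl_pres k) (Cl_EE k); rewrite scale0r. Qed.

Lemma cFF : cF * cF = 0.
Proof. by have /= := pgen_rel (P := Cl_pres k) (Cl_FF k); rewrite scale0r. Qed.

Lemma cEF : cE * cF + cF * cE = 1.
Proof. by have /= := pgen_rel (P := Cl_pres k) (Cl_EF k); rewrite scale1r. Qed.

Section UkLift.
Variables (A : algType k) (a a' : A).
Hypotheses (aa' : a * a' = 1) (a'a : a' * a = 1).
Local Notation f := (fun g => match g with UkK => a | UkK' => a' end).

Lemma Uk_lift_rels s t : Uk_rel s t -> eval f s = eval f t.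
Proof. by case; rewrite /= scale1r. Qed.

Lemma Uk_liftK : Uk_lift a a' K0 = a.
Proof. exact: (lift_gen (P := Uk_pres k) Uk_lift_rels). Qed.

Lemma Uk_liftK' : Uk_lift a a' K0' = a'.
Proof. exact: (lift_gen (P := Uk_pres k) Uk_lift_rels). Qed.

Lemma Uk_lift_scal c : Uk_lift a a' c%:A = c%:A.
Proof. exact: (lift_scal (P := Uk_pres k) Uk_lift_rels). Qed.

Lemma Uk_liftD : {morph Uk_lift a a' : x y / x + y}.
Proof. exact: (liftD (P := Uk_pres k) Uk_lift_rels). Qed.

Lemma Uk_liftM : {morph Uk_lift a a' : x y / x * y}.
Proof. exact: (liftM (P := Uk_pres k) Uk_lift_rels). Qed.

End UkLift.

Lemma Uk_ind (Q : Uk k -> Prop) :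
  Q K0 -> Q K0' -> (forall c, Q c%:A) ->
  (forall x y, Q x -> Q y -> Q (x + y)) ->
  (forall x y, Q x -> Q y -> Q (x * y)) -> forall x, Q x.
Proof. by move=> *; apply: (presalg_ind (P := Uk_pres k)) => // -[]. Qed.

Lemma Uk_comm (x y : Uk k) : x * y = y * x.
Proof.
have commK0 : K0 * K0' = K0' * K0 by rewrite K0K0' K0'K0.
have comm0 u : (u = K0 \/ u = K0') -> forall x : Uk k, x * u = u * x.
  move=> eu; elim/Uk_ind => [||c|x1 x2 IH1 IH2|x1 x2 IH1 IH2].
  - by case: eu => ->.
  - by case: eu => ->.
  - by rewrite mulr_algl mulr_algr.
  - by rewrite mulrDl mulrDr IH1 IH2.
  - by rewrite -mulrA IH2 mulrA IH1 mulrA.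
move: y; elim/Uk_ind => [||c|y1 y2 IH1 IH2|y1 y2 IH1 IH2].
- by apply: comm0; left.
- by apply: comm0; right.
- by rewrite mulr_algl mulr_algr.
- by rewrite mulrDl mulrDr IH1 IH2.
- by rewrite mulrA IH1 -mulrA IH2 mulrA.
Qed.

Hypothesis q0 : q != 0.

Lemma alpha_idem : cE * cF * (cE * cF) = cE * cF.
Proof.
have : cE * (cE * cF + cF * cE) * cF = cE * cF by rewrite cEF mulr1.
by rewrite mulrDr mulrA cEE mul0r add0r !mulrA.
Qed.

Lemma idem_mul1 (p : Cl k) (r s t : k) : p * p = p -> t * s = 1 -> r = s - t ->
  (t%:A + r *: p) * (s%:A - r *: p) = 1.
Proof.
move=> pp ts ->.
rewrite mulrBr !mulrDl !mulr_algl !scalerA -!scalerAl !mulr_algr -!scalerAr pp.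
rewrite !scalerA ts scale1r -addrA -[RHS]addr0; congr (_ + _).
rewrite -scalerDl -scalerBl [X in X *: _](_ : _ = 0) ?scale0r //.
by ring.
Qed.

Lemma idem_mul1' (p : Cl k) (r s t : k) : p * p = p -> s * t = 1 -> r = s - t ->
  (s%:A - r *: p) * (t%:A + r *: p) = 1.
Proof.
move=> pp st rE; have := idem_mul1 (r := - r) pp st.
by rewrite scaleNr opprK rE opprB; apply.
Qed.

Let aKK' := idem_mul1 alpha_idem (mulVf q0) erefl.
Let aK'K := idem_mul1' alpha_idem (mulfV q0) erefl.

Lemma alphaK : alpha q K0 = q^-1%:A + (q - q^-1) *: (cE * cF).
Proof. exact: (Uk_liftK aKK' aK'K). Qed.

Lemma alphaK' : alpha q K0' = q%:A - (q - q^-1) *: (cE * cF).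
Proof. exact: (Uk_liftK' aKK' aK'K). Qed.

Lemma alphaKK' : alpha q K0 * alpha q K0' = 1.
Proof. by rewrite alphaK alphaK' aKK'. Qed.

Lemma alphaK'K : alpha q K0' * alpha q K0 = 1.
Proof. by rewrite alphaK alphaK' aK'K. Qed.

Lemma deltaKK' : (K \ox alpha q K0) * (K' \ox alpha q K0') = 1.
Proof. by rewrite tensM KK' alphaKK'. Qed.

Lemma deltaK'K : (K' \ox alpha q K0') * (K \ox alpha q K0) = 1.
Proof. by rewrite tensM K'K alphaK'K. Qed.

Lemma sigmaKK' : (q *: K0) * (q^-1 *: K0') = 1.
Proof. by rewrite -scalerAl -scalerAr scalerA mulfV // scale1r K0K0'. Qed.

Lemma sigmaK'K : (q^-1 *: K0') * (q *: K0) = 1.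
Proof. by rewrite -scalerAl -scalerAr scalerA mulVf // scale1r K0'K0. Qed.

Lemma deltaK : delta q K0 = K \ox alpha q K0.
Proof. exact: (Uk_liftK deltaKK' deltaK'K). Qed.

Lemma deltaK' : delta q K0' = K' \ox alpha q K0'.
Proof. exact: (Uk_liftK' deltaKK' deltaK'K). Qed.

Lemma sigmaK : sigma q K0 = q *: K0.
Proof. exact: (Uk_liftK sigmaKK' sigmaK'K). Qed.

Lemma sigmaK' : sigma q K0' = q^-1 *: K0'.
Proof. exact: (Uk_liftK' sigmaKK' sigmaK'K). Qed.

Local Notation iota := (iota q).

Lemma iotaK : iota K0 = K. Proof. exact: (Uk_liftK KK' K'K). Qed.
Lemma iotaK' : iota K0' = K'. Proof. exact: (Uk_liftK' KK' K'K). Qed.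
Lemma iota_scal c : iota c%:A = c%:A. Proof. exact: (Uk_lift_scal KK' K'K). Qed.
Lemma iotaD : {morph iota : x y / x + y}. Proof. exact: (Uk_liftD KK' K'K). Qed.
Lemma iotaM : {morph iota : x y / x * y}. Proof. exact: (Uk_liftM KK' K'K). Qed.

Lemma iota0 : iota 0 = 0.
Proof. by rewrite -(scale0r (1 : Uk k)) iota_scal scale0r. Qed.

Lemma iota1 : iota 1 = 1.
Proof. by rewrite -(scale1r (1 : Uk k)) iota_scal scale1r. Qed.

Lemma iotaZ c h : iota (c *: h) = c *: iota h.
Proof. by rewrite -mulr_algl iotaM iota_scal mulr_algl. Qed.

Lemma K'E : K' * E = q ^- 2 *: (E * K').
Proof.
have -> : E * K' = K' * (K * E) * K' by rewrite mulrA K'K mul1r.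
rewrite KE -scalerAr -scalerAl scalerA mulVf ?expf_neq0 // scale1r.
by rewrite -!mulrA KK' mulr1.
Qed.

Lemma FK h : exists h', F * iota h = iota h' * F.
Proof.
elim/Uk_ind: h => [||c|h1 h2 [h1' e1] [h2' e2]|h1 h2 [h1' e1] [h2' e2]].
- exists (q ^+ 2 *: K0); rewrite iotaZ iotaK -scalerAl KF scalerA.
  by rewrite mulfV ?expf_neq0 // scale1r.
- exists (q ^- 2 *: K0'); rewrite iotaZ iotaK' -scalerAl.
  have -> : F * K' = K' * (K * F) * K' by rewrite mulrA K'K mul1r.
  by rewrite KF -scalerAr -scalerAl -!mulrA KK' mulr1.
- by exists c%:A; rewrite iota_scal mulr_algl mulr_algr.
- by exists (h1' + h2'); rewrite !iotaD mulrDr mulrDl e1 e2.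
- by exists (h1' * h2'); rewrite !iotaM mulrA e1 -mulrA e2 mulrA.
Qed.

(* Linear combinations of the monomials E^i K^j F^l. *)
Inductive ordered : Uq q -> Prop :=
| ordered0 : ordered 0
| orderedD i h l u : ordered u -> ordered (E ^+ i * iota h * F ^+ l + u).

Lemma ordered_mon i h l : ordered (E ^+ i * iota h * F ^+ l).
Proof. by rewrite -[_ * _]addr0; apply/orderedD/ordered0. Qed.

Lemma ordered_add u v : ordered u -> ordered v -> ordered (u + v).
Proof.
move=> ou ov; elim: ou => [|i h l u' _ IHu]; first by rewrite add0r.
by rewrite -addrA; apply: orderedD.
Qed.

Lemma ordered_linear (f : Uq q -> Uq q) : f 0 = 0 ->
  {morph f : x y / x + y} ->
  (forall i h l, ordered (f (E ^+ i * iota h * F ^+ l))) ->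
  forall u, ordered u -> ordered (f u).
Proof.
move=> f0 fD fmon u; elim=> [|i h l u' _ IHu].
  by rewrite f0; apply: ordered0.
by rewrite fD; apply: ordered_add.
Qed.

Lemma ordered_mull x : (forall i h l, ordered (x * (E ^+ i * iota h * F ^+ l))) ->
  forall u, ordered u -> ordered (x * u).
Proof.
by apply: (ordered_linear (f := fun u => x * u)) => [|u v];
  rewrite ?mulr0 ?mulrDr.
Qed.

Lemma ordered_scale c u : ordered u -> ordered (c *: u).
Proof.
rewrite -mulr_algl; apply: ordered_mull => i h l.
by rewrite mulr_algl scalerAl scalerAr -iotaZ; apply: ordered_mon.
Qed.

Lemma ordered_E u : ordered u -> ordered (E * u).
Proof.
by apply: ordered_mull => i h l; rewrite !mulrA -exprS; apply: ordered_mon.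
Qed.

Lemma ordered_K u : ordered u -> ordered (K * u).
Proof.
apply: ordered_mull => i h l.
have -> : K * (E ^+ i * iota h * F ^+ l) =
    (q ^+ 2) ^+ i *: (E ^+ i * (K * iota h) * F ^+ l).
  rewrite !mulrA; elim: i => [|i IHi]; first by rewrite !expr0 scale1r mul1r mulr1.
  rewrite (exprS E) (exprS (q ^+ 2)) !mulrA KE -!scalerAl -!(mulrA E) IHi.
  by rewrite -scalerAr scalerA !mulrA.
by apply: ordered_scale; rewrite -iotaK -iotaM; apply: ordered_mon.
Qed.

Lemma ordered_K' u : ordered u -> ordered (K' * u).
Proof.
apply: ordered_mull => i h l.
have -> : K' * (E ^+ i * iota h * F ^+ l) =
    (q ^- 2) ^+ i *: (E ^+ i * (K' * iota h) * F ^+ l).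
  rewrite !mulrA; elim: i => [|i IHi]; first by rewrite !expr0 scale1r mul1r mulr1.
  rewrite (exprS E) (exprS (q ^- 2)) !mulrA K'E -!scalerAl -!(mulrA E) IHi.
  by rewrite -scalerAr scalerA !mulrA.
by apply: ordered_scale; rewrite -iotaK' -iotaM; apply: ordered_mon.
Qed.

Lemma ordered_F u : ordered u -> ordered (F * u).
Proof.
apply: ordered_mull => i h l; elim: i => [|i IHi].
  have [h' e] := FK h.
  rewrite expr0 mul1r mulrA e -mulrA -exprS.
  by have := ordered_mon 0 h' l.+1; rewrite expr0 mul1r.
have -> : F * (E ^+ i.+1 * iota h * F ^+ l) =
  E * (F * (E ^+ i * iota h * F ^+ l)) +
  - (q - q^-1)^-1 *: (K * (E ^+ i * iota h * F ^+ l)) +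
  (q - q^-1)^-1 *: (K' * (E ^+ i * iota h * F ^+ l)).
  have FE : F * E = E * F - (q - q^-1)^-1 *: (K - K').
    by rewrite -EF opprB addrC subrK.
  rewrite exprS !mulrA FE !mulrBl -!scalerAl !mulrBl scalerBr opprB.
  by rewrite scaleNr -addrA [- _ + _]addrC.
apply: ordered_add; [apply: ordered_add|].
- exact: ordered_E.
- by apply: ordered_scale; apply: ordered_K; apply: ordered_mon.
- by apply: ordered_scale; apply: ordered_K'; apply: ordered_mon.
Qed.

Lemma ordered_all u : ordered u.
Proof.
suff H v : ordered v -> ordered (u * v).
  rewrite -[u]mulr1; apply: H.
  by have := ordered_mon 0 1 0; rewrite !expr0 iota1 !mulr1.
move: v; elim/(presalg_ind (P := Uq_pres q)): u => [[]|c|x y IHx IHy|x y IHx IHy] v ov.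
- exact: ordered_K.
- exact: ordered_K'.
- exact: ordered_E.
- exact: ordered_F.
- by rewrite mulr_algl; apply: ordered_scale.
- by rewrite mulrDl; apply: ordered_add; [apply: IHx|apply: IHy].
- by rewrite -mulrA; apply/IHx/IHy.
Qed.

Lemma HC_decomposition u : exists h x y, u = iota h + E * x + y * F.
Proof.
elim: (ordered_all u) => [|i h l v _ [h' [x [y ->]]]].
  by exists 0, 0, 0; rewrite iota0 mulr0 mul0r !addr0.
case: i => [|i].
  case: l => [|l].
    exists (h + h'), x, y.
    by rewrite !expr0 mul1r mulr1 iotaD !addrA.
  exists h', x, (iota h * F ^+ l + y).
  by rewrite expr0 mul1r exprSr mulrA mulrDl addrCA.
exists h', (E ^+ i * iota h * F ^+ l + x), y.
by rewrite exprS mulrDr !mulrA !addrA [_ + iota h']addrC.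
Qed.

(* The left module U / U F: functions on nat with values in C[K, K^-1],
   standing for (infinite) sums of the E^i h, h in C[K, K^-1]. *)
Local Notation M := (nat -> Uk k).

Definition verma_coef (n : nat) : Uk k :=
  (q - q^-1)^-1 *: \sum_(s < n) (q ^+ 2 ^+ s *: K0 - q ^- 2 ^+ s *: K0').

Definition verma_gen (g : Uq_gen) (m : M) : M := fun i =>
  match g with
  | UqK => q ^+ 2 ^+ i *: (K0 * m i)
  | UqK' => q ^- 2 ^+ i *: (K0' * m i)
  | UqE => if i is i'.+1 then m i' else 0
  | UqF => - (verma_coef i.+1 * m i.+1)
  end.

Fixpoint verma_act (t : pterm k Uq_gen) (m : M) : M :=
  match t with
  | Gen g => verma_gen g m
  | Scal c => fun i => c *: m i
  | Add s t => fun i => verma_act s m i + verma_act t m i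
  | Mul s t => verma_act s (verma_act t m)
  end.

Lemma verma_actD t m m' :
  verma_act t (fun i => m i + m' i) = fun i => verma_act t m i + verma_act t m' i.
Proof.
elim: t m m' => [[]|c|s IHs t IHt|s IHs t IHt] m m'; apply/funext => i /=.
- by rewrite mulrDr scalerDr.
- by rewrite mulrDr scalerDr.
- by case: i => //=; rewrite addr0.
- by rewrite mulrDr opprD.
- by rewrite scalerDr.
- by rewrite IHs IHt addrACA.
- by rewrite IHt IHs.
Qed.

Lemma verma_actZ t c m :
  verma_act t (fun i => c *: m i) = fun i => c *: verma_act t m i.
Proof.
elim: t m => [[]|d|s IHs t IHt|s IHs t IHt] m; apply/funext => i /=.
- by rewrite -scalerAr !scalerA mulrC.
- by rewrite -scalerAr !scalerA mulrC.
- by case: i => //=; rewrite scaler0.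
- by rewrite -scalerAr scalerN.
- by rewrite !scalerA mulrC.
- by rewrite IHs IHt scalerDr.
- by rewrite IHt IHs.
Qed.

Lemma verma_coefS n : verma_coef n.+1 =
  verma_coef n + (q - q^-1)^-1 *: (q ^+ 2 ^+ n *: K0 - q ^- 2 ^+ n *: K0').
Proof. by rewrite /verma_coef big_ord_recr /= scalerDr. Qed.

Lemma verma_act_eq s t : pres_eq (@Uq_rel k q) s t -> verma_act s = verma_act t.
Proof.
elim=> {s t} //=.
- move=> s t [] /=; apply/funext => m; apply/funext => i /=.
  + rewrite -scalerAr scalerA mulrA K0K0' mul1r -exprMn mulfV ?expf_neq0 //.
    by rewrite expr1n.
  + rewrite -scalerAr scalerA mulrA K0'K0 mul1r -exprMn mulVf ?expf_neq0 //.
    by rewrite expr1n.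
  + case: i => [|i] /=; first by rewrite mulr0 !scaler0.
    by rewrite scalerA -(exprS (q ^+ 2)).
  + rewrite mulrN -!scalerAr !scalerN scalerA (exprS (q ^+ 2)) mulKf ?expf_neq0 //.
    by rewrite !mulrA [K0 * _]Uk_comm.
  + have -> : (if i is i'.+1 then - (verma_coef i'.+1 * m i'.+1) else 0) =
        - (verma_coef i * m i).
      by case: i => //; rewrite /verma_coef big_ord0 scaler0 mul0r oppr0.
    rewrite !scaleN1r opprK verma_coefS mulrDl addrA addNr add0r.
    by rewrite -scalerAl mulrBl -!scalerAl.
- by move=> s t u _ -> _ ->.
- by move=> s s' t t' _ -> _ ->.
- by move=> s s' t t' _ -> _ ->.
- by move=> s t u; apply/funext => m; apply/funext => i; rewrite addrA.
- by move=> s t; apply/funext => m; apply/funext => i; rewrite addrC.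
- by move=> t; apply/funext => m; apply/funext => i; rewrite scale0r add0r.
- by move=> t; apply/funext => m; apply/funext => i; rewrite scale1r.
- move=> t; apply/funext => m; congr (verma_act t _).
  by apply/funext => i; rewrite scale1r.
- by move=> t; apply/funext => m; apply/funext => i; rewrite !scale0r.
- by move=> s t u; apply/funext => m; rewrite verma_actD.
- by move=> c d; apply/funext => m; apply/funext => i; rewrite scalerDl.
- by move=> c d; apply/funext => m; apply/funext => i; rewrite scalerA.
- by move=> c t; apply/funext => m; rewrite verma_actZ.
Qed.

Definition verma (u : Uq q) : M -> M := verma_act (repr u).

Lemma verma_pi t : verma (pi_term (P := Uq_pres q) t) = verma_act t.
Proof. exact/verma_act_eq/(repr_pi_term (P := Uq_pres q)). Qed.

Lemma vermaD u v m i : verma (u + v) m i = verma u m i + verma v m i.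
Proof.
elim/(pi_term_ind (P := Uq_pres q)): u => s; elim/(pi_term_ind (P := Uq_pres q)): v => t.
by rewrite -pi_termD !verma_pi.
Qed.

Lemma vermaM u v m : verma (u * v) m = verma u (verma v m).
Proof.
elim/(pi_term_ind (P := Uq_pres q)): u => s; elim/(pi_term_ind (P := Uq_pres q)): v => t.
by rewrite -pi_termM !verma_pi.
Qed.

Lemma verma_iota h m : verma (iota h) m 0%N = h * m 0%N.
Proof.
elim/Uk_ind: h m => [||c|h1 h2 IH1 IH2|h1 h2 IH1 IH2] m.
- by rewrite iotaK verma_pi /= scale1r.
- by rewrite iotaK' verma_pi /= scale1r.
- by rewrite iota_scal -(pi_termS (Uq_pres q)) verma_pi /= mulr_algl.
- by rewrite iotaD vermaD IH1 IH2 mulrDl.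
- by rewrite iotaM vermaM IH1 IH2 mulrA.
Qed.

Lemma HC_part_unique h x y : iota h = E * x + y * F -> h = 0.
Proof.
pose m0 : M := fun i => if i is 0%N then 1 else 0.
move=> /(congr1 (fun u => verma u m0 0%N)).
have vE : verma E = verma_gen UqE := verma_pi (Gen k UqE).
have vF : verma F = verma_gen UqF := verma_pi (Gen k UqF).
rewrite verma_iota /= mulr1 vermaD !vermaM vE vF /= add0r.
have -> : verma_gen UqF m0 = fun i => 0 *: m0 i.
  by apply/funext => i /=; rewrite mulr0 oppr0 scale0r.
by rewrite /verma verma_actZ scale0r.
Qed.

Lemma iota_inj : injective iota.
Proof.
move=> h h' e; apply/eqP; rewrite -subr_eq0; apply/eqP.
apply: (@HC_part_unique _ 0 0).
by rewrite iotaD -scaleN1r iotaZ e scaleN1r subrr mulr0 mul0r addr0.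
Qed.

Lemma muP u : exists x y, u = iota (mu u) + E * x + y * F.
Proof.
rewrite /mu; case: xgetP => [h _ //|nex].
by case: (HC_decomposition u) => h [x [y e]]; case: (nex h); exists x, y.
Qed.

Lemma mu_eq u h x y : u = iota h + E * x + y * F -> mu u = h.
Proof.
have [x' [y' e]] := muP u => e'.
apply/eqP; rewrite -subr_eq0; apply/eqP; apply: (@HC_part_unique _ (x - x') (y - y')).
rewrite iotaD -scaleN1r iotaZ scaleN1r mulrBr mulrBl addrACA -opprD; apply/eqP.
rewrite subr_eq [X in _ == X]addrC addrA eq_sym subr_eq !addrA.
by rewrite -e' -e.
Qed.

End Relations.

(* Main.v *)
From mathcomp Require Import all_boot all_order all_algebra.
From mathcomp Require Import boolp functions zify.
From mathcomp Require Import reals complex.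
Require Import Defs.

Import GRing.Theory.
Local Open Scope ring_scope.

Set Implicit Arguments.
Unset Strict Implicit.
Unset Printing Implicit Defensive.

(** The Clifford algebra is the algebra of 2 x 2 matrices, with cE and cF the two
off-diagonal matrix units, so U (x) C(p) consists of 2 x 2 matrices over
U = U_q(sl_2), the Dirac operator being ((0, F), (E, 0)).  For an off-diagonal
a = ((0, b), (c, 0)) the anticommutator D a + a D is the diagonal matrix with
entries F c + b E and E b + c F, while delta(sigma(h)) is diagonal with entries
sigma^2(h) and h.  With h = mu(z), the theorem thus asks for b of weight q^-2
and c of weight q^2 under K such that

  z = h + E b + c F   and   z = sigma^2(h) + b E + F c.

The first equation is the triangular decomposition of z.  To get the second one
from it, b and c are chosen so that u = h + E b has only terms of degree >= 0
and v = c F only terms of degree < 0 for the grading deg E = 1, deg F = -1,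
deg K = 0.  If z = u + v is central and x is homogeneous, the commutators [u, x]
and [v, x] are opposite but have no degree in common, so both vanish
(comm_summands).  Now u E = E u and h E = E sigma^2(h) give
E (h + E b) = E (sigma^2(h) + b E), and F v = v F gives (F c) F = (c F) F;
cancelling E on the left and F on the right yields the second equation
(central_decomposition).  The weights of b and c follow in the same way from the
commutation of u and v with K.

This argument is insensitive to q being a root of unity, in which case a central
element may have components of nonzero degree, such as powers of E and F.

The cancellations (E_lreg, F_rreg) and the independence of the degrees
(deg_disjoint) rest on the linear independence of the ordered monomials
E^i K^j F^l.  It is obtained by letting U act on families of Laurent polynomials
in K indexed by (i, l), through the formulas that left multiplication has to
satisfy on ordered monomials; acting on the family of the monomial 1 then reads
off the coefficients of any element (pbw_mono, pbw_expansion). *)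

(** * Modules over a presented algebra *)

Section PresentedModule.
Variables (k : fieldType) (P : presentation k) (V : lmodType k).
Variable f : gen P -> V -> V.

Fixpoint term_act (t : pterm k (gen P)) (m : V) : V :=
  match t with
  | Gen g => f g m
  | Scal c => c *: m
  | Add s t => term_act s m + term_act t m
  | Mul s t => term_act s (term_act t m)
  end.

Hypothesis f_linear : forall g, linear (f g).
Hypothesis f_rels : forall s t, rels s t -> term_act s =1 term_act t.

Lemma term_act_linear t : linear (term_act t).
Proof.
elim: t => [g|d|s IHs t IHt|s IHs t IHt] c m m' /=; first exact: f_linear.
- by rewrite scalerDr !scalerA mulrC.
- by rewrite IHs IHt scalerDr addrACA.
- by rewrite IHt IHs.
Qed.

Lemma term_actD t m m' : term_act t (m + m') = term_act t m + term_act t m'.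
Proof. by rewrite -[m]scale1r term_act_linear !scale1r. Qed.

Lemma term_act0 t : term_act t 0 = 0.
Proof. by apply: (addrI (term_act t 0)); rewrite -term_actD !addr0. Qed.

Lemma term_actZ t c m : term_act t (c *: m) = c *: term_act t m.
Proof. by rewrite -[c *: m]addr0 term_act_linear term_act0 addr0. Qed.

Lemma term_act_eq s t : pres_eq (@rels k P) s t -> term_act s =1 term_act t.
Proof.
elim=> {s t} /=.
- exact: f_rels.
- by [].
- by move=> s t _ IH m.
- by move=> s t u _ IH _ IH' m; rewrite IH.
- by move=> s s' t t' _ IH _ IH' m /=; rewrite IH IH'.
- by move=> s s' t t' _ IH _ IH' m /=; rewrite IH' IH.
- by move=> s t u m /=; rewrite addrA.
- by move=> s t m /=; rewrite addrC.
- by move=> t m /=; rewrite scale0r add0r.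
- by [].
- by move=> t m /=; rewrite scale1r.
- by move=> t m /=; rewrite scale1r.
- by move=> t m /=; rewrite !scale0r.
- by [].
- by move=> s t u m /=; rewrite term_actD.
- by move=> c d m /=; rewrite scalerDl.
- by move=> c d m /=; rewrite scalerA.
- by move=> c t m /=; rewrite term_actZ.
Qed.

Definition act (u : presalg P) : V -> V := term_act (repr u).

Lemma act_pi t : act (pi_term t) =1 term_act t.
Proof. exact/term_act_eq/repr_pi_term. Qed.

Lemma act_gen g : act (pgen g) =1 f g.
Proof. exact: act_pi. Qed.

Lemma actDl u v m : act (u + v) m = act u m + act v m.
Proof.
elim/pi_term_ind: u => s; elim/pi_term_ind: v => t.
by rewrite -pi_termD !act_pi.
Qed.

Lemma actM u v m : act (u * v) m = act u (act v m).
Proof.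
elim/pi_term_ind: u => s; elim/pi_term_ind: v => t.
by rewrite -pi_termM !act_pi.
Qed.

Lemma act_scal c m : act c%:A m = c *: m.
Proof. by rewrite -pi_termS act_pi. Qed.

Lemma act1 m : act 1 m = m.
Proof. by rewrite -[1]scale1r act_scal scale1r. Qed.

Lemma act0l m : act 0 m = 0.
Proof. by rewrite -(scale0r 1) act_scal scale0r. Qed.

Lemma actNl u m : act (- u) m = - act u m.
Proof. by rewrite -mulN1r -scaleN1r actM act_scal scaleN1r. Qed.

End PresentedModule.

(** * The regular representation in the basis of ordered monomials *)

Section Quantum.
Variables (k : fieldType) (q : k).
Hypothesis q0 : q != 0.
Local Notation K := (K q).
Local Notation K' := (K' q).
Local Notation E := (E q).
Local Notation F := (F q).
Local Notation K0 := (K0 k).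
Local Notation K0' := (K0' k).
Local Notation cE := (cE k).
Local Notation cF := (cF k).
Local Notation iota := (iota q).
Local Notation sigma := (sigma q).

Lemma sigmaD : {morph sigma : x y / x + y}.
Proof. exact: (Uk_liftD (sigmaKK' q0) (sigmaK'K q0)). Qed.

Lemma sigmaM : {morph sigma : x y / x * y}.
Proof. exact: (Uk_liftM (sigmaKK' q0) (sigmaK'K q0)). Qed.

Lemma sigma_scal c : sigma c%:A = c%:A.
Proof. exact: (Uk_lift_scal (sigmaKK' q0) (sigmaK'K q0)). Qed.

Lemma sigmaZ c x : sigma (c *: x) = c *: sigma x.
Proof. by rewrite -mulr_algl sigmaM sigma_scal mulr_algl. Qed.

(** The substitution of q^2 K for K, by which Laurent polynomials in K move across
E and F. *)
Definition sigma2 (h : Uk k) : Uk k := sigma (sigma h).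

Lemma sigma2D : {morph sigma2 : x y / x + y}.
Proof. by move=> x y; rewrite /sigma2 !sigmaD. Qed.

Lemma sigma2M : {morph sigma2 : x y / x * y}.
Proof. by move=> x y; rewrite /sigma2 !sigmaM. Qed.

Lemma sigma2_scal c : sigma2 c%:A = c%:A.
Proof. by rewrite /sigma2 !sigma_scal. Qed.

Lemma sigma2_0 : sigma2 0 = 0.
Proof. by rewrite -(scale0r 1) sigma2_scal. Qed.

Lemma sigma2_1 : sigma2 1 = 1.
Proof. by rewrite -(scale1r 1) sigma2_scal. Qed.

Lemma sigma2Z c x : sigma2 (c *: x) = c *: sigma2 x.
Proof. by rewrite /sigma2 !sigmaZ. Qed.

Lemma sigma2K : sigma2 K0 = q ^+ 2 *: K0.
Proof. by rewrite /sigma2 (sigmaK q0) sigmaZ (sigmaK q0) scalerA. Qed.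

Lemma sigma2K' : sigma2 K0' = q ^- 2 *: K0'.
Proof.
by rewrite /sigma2 (sigmaK' q0) sigmaZ (sigmaK' q0) scalerA -invfM.
Qed.

Lemma iota_E h : iota h * E = E * iota (sigma2 h).
Proof.
elim/Uk_ind: h => [||c|x y IHx IHy|x y IHx IHy].
- by rewrite sigma2K iotaZ // iotaK // KE scalerAr.
- by rewrite sigma2K' iotaZ // iotaK' // K'E // scalerAr.
- by rewrite sigma2_scal iota_scal // mulr_algl mulr_algr.
- by rewrite sigma2D !iotaD // mulrDl mulrDr IHx IHy.
- by rewrite sigma2M !iotaM // -mulrA IHy !mulrA IHx.
Qed.

Local Notation M := (nat -> nat -> Uk k).

(** Left multiplication on ordered monomials, m i j standing for the coefficient h
of E^i h F^j.  In the case of F, the first term comes from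
F E^(i+1) = E^(i+1) F - E^i verma_coef(i+1), and the second from
F h = sigma2(h) F.  Keeping the powers of F, as opposed to working in the Verma
module U / U F, makes the action faithful also when q is a root of unity. *)
Definition pbw_gen (g : Uq_gen) (m : M) : M := fun i j =>
  match g with
  | UqK => q ^+ 2 ^+ i *: (K0 * m i j)
  | UqK' => q ^- 2 ^+ i *: (K0' * m i j)
  | UqE => if i is i'.+1 then m i' j else 0
  | UqF => - (verma_coef q i.+1 * m i.+1 j)
           + (if j is j'.+1 then sigma2 (m i j') else 0)
  end.

Lemma pbw_gen_linear g : linear (pbw_gen g).
Proof.
move=> c m m'; apply/funext => i; apply/funext => j.
have e (n n' : M) a b : (c *: n + n') a b = c *: n a b + n' a b by [].
rewrite e; case: g => /=; rewrite ?e.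
- by rewrite mulrDr scalerDr -scalerAr !scalerA mulrC.
- by rewrite mulrDr scalerDr -scalerAr !scalerA mulrC.
- by case: i => [|i]; rewrite ?e // scaler0 addr0.
- rewrite mulrDr opprD scalerDr -scalerAr scalerN addrACA; congr (_ + _).
  by case: j => [|j]; rewrite ?scaler0 ?addr0 // e sigma2D sigma2Z.
Qed.

(** Apart from the second term of F, the formulas are those of the universal Verma
module for each j.  This second term commutes with the action of E and is of
weight q^-2 for K because sigma2(K) = q^2 K. *)
Lemma pbw_gen_rels s t :
  @rels k (Uq_pres q) s t ->
  term_act (P := Uq_pres q) pbw_gen s =1 term_act (P := Uq_pres q) pbw_gen t.
Proof.
case=> m /=; apply/funext => i; apply/funext => j.
- rewrite /= -scalerAr scalerA mulrA K0K0' mul1r -exprMn mulfV ?expf_neq0 //.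
  by rewrite expr1n.
- rewrite /= -scalerAr scalerA mulrA K0'K0 mul1r -exprMn mulVf ?expf_neq0 //.
  by rewrite expr1n.
- have e c (n : M) a b : (c *: n) a b = c *: n a b by [].
  rewrite e /=; case: i => [|i]; first by rewrite mulr0 !scaler0.
  by rewrite scalerA -(exprS (q ^+ 2)).
- have e c (n : M) a b : (c *: n) a b = c *: n a b by [].
  rewrite e /= mulrDr !scalerDr; congr (_ + _).
    rewrite mulrN -!scalerAr !scalerN scalerA (exprS (q ^+ 2)) mulKf ?expf_neq0 //.
    by rewrite !mulrA [K0 * _]Uk_comm.
  case: j => [|j]; first by rewrite mulr0 !scaler0.
  rewrite sigma2Z sigma2M sigma2K -scalerAl !scalerA; congr (_ *: _).
  by rewrite mulrAC mulVf ?mul1r ?expf_neq0.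
- have eD (n n' : M) a b : (n + n') a b = n a b + n' a b by [].
  have e c (n : M) a b : (c *: n) a b = c *: n a b by [].
  rewrite eD !e eD e /=.
  (* verma_coef vanishes at 0, so E F obeys the same formula at i = 0. *)
  have -> : (if i is i'.+1 then - (verma_coef q i'.+1 * m i'.+1 j)
                + (if j is j'.+1 then sigma2 (m i' j') else 0) else 0) =
        - (verma_coef q i * m i j)
        + (if j is j'.+1 then
             sigma2 (if i is i'.+1 then m i' j' else 0) else 0).
    case: i => //; rewrite /verma_coef big_ord0 scaler0 mul0r oppr0 add0r.
    by case: j => // j; rewrite sigma2_0.
  rewrite !scaleN1r opprD opprK addrACA subrr addr0 verma_coefS mulrDl addrA.
  by rewrite addNr add0r -scalerAl mulrBl -!scalerAl.
Qed.

Local Notation pact := (act (P := Uq_pres q) pbw_gen).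
Let pactM := actM (P := Uq_pres q) pbw_gen_linear pbw_gen_rels.
Let pactDl := actDl (P := Uq_pres q) pbw_gen_linear pbw_gen_rels.
Let pact_gen := act_gen (P := Uq_pres q) pbw_gen_linear pbw_gen_rels.
Let pact_scal := act_scal (P := Uq_pres q) pbw_gen_linear pbw_gen_rels.
Let pact0 := act0l (P := Uq_pres q) pbw_gen_linear pbw_gen_rels.
Let pactN := actNl (P := Uq_pres q) pbw_gen_linear pbw_gen_rels.
Let pact1 := act1 (P := Uq_pres q) pbw_gen_linear pbw_gen_rels.

Definition mono (i j : nat) (h : Uk k) : M :=
  fun a b => if (a == i) && (b == j) then h else 0.

Definition pbw (u : Uq q) : M := pact u (mono 0 0 1).

Lemma pact_F_mono l h : pact F (mono 0 l h) = mono 0 l.+1 (sigma2 h).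
Proof.
rewrite pact_gen; apply/funext => i; apply/funext => j.
rewrite /= /mono /= mulr0 oppr0 add0r.
case: j => [|j]; first by rewrite andbF.
by rewrite eqSS; case: ifP => // _; rewrite sigma2_0.
Qed.

Lemma pact_E_mono i l h : pact E (mono i l h) = mono i.+1 l h.
Proof. by rewrite pact_gen; apply/funext => -[|a]; apply/funext => b. Qed.

Lemma pact_iota_mono l g h : pact (iota h) (mono 0 l g) = mono 0 l (h * g).
Proof.
elim/Uk_ind: h g => [||c|x y IHx IHy|x y IHx IHy] g.
- rewrite iotaK // pact_gen; apply/funext => -[|a]; apply/funext => b /=.
    by rewrite /mono /= scale1r; case: ifP => // _; rewrite mulr0.
  by rewrite /mono /= mulr0 scaler0.
- rewrite iotaK' // pact_gen; apply/funext => -[|a]; apply/funext => b /=.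
    by rewrite /mono /= scale1r; case: ifP => // _; rewrite mulr0.
  by rewrite /mono /= mulr0 scaler0.
- rewrite iota_scal // pact_scal mulr_algl.
  apply/funext => a; apply/funext => b; rewrite /mono /=.
  by rewrite -[(_ *: _) a b]/(c *: _); case: ifP => // _; rewrite scaler0.
- rewrite iotaD // pactDl IHx IHy mulrDl.
  apply/funext => a; apply/funext => b; rewrite -[(_ + _) a b]/(_ + _) /mono.
  by case: ifP => // _; rewrite addr0.
- by rewrite iotaM // pactM IHy IHx mulrA.
Qed.

Lemma pbw_mono i h l : pbw (E ^+ i * iota h * F ^+ l) = mono i l h.
Proof.
have pF : pact (F ^+ l) (mono 0 0 1) = mono 0 l 1.
  elim: l => [|l IHl]; first by rewrite expr0 pact1.
  by rewrite exprS pactM IHl pact_F_mono sigma2_1.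
rewrite /pbw !pactM pF pact_iota_mono mulr1.
elim: i => [|i IHi]; first by rewrite expr0 pact1.
by rewrite exprS pactM IHi pact_E_mono.
Qed.

Lemma pbwD u v : pbw (u + v) = pbw u + pbw v.
Proof. exact: pactDl. Qed.

(** Together with pbw_mono this is the basis theorem.  The square range of
summation may be any large enough one, so that two elements can be expanded
over a common range. *)
Lemma pbw_expansion u : exists N, forall n, (N <= n)%N ->
  u = \sum_(i < n) \sum_(j < n) E ^+ i * iota (pbw u i j) * F ^+ j.
Proof.
elim: (ordered_all q0 u) => [|a h b v _ [N IH]].
  exists 0%N => n _; rewrite big1 // => i _; rewrite big1 // => j _.
  by rewrite /pbw pact0 iota0 mulr0 mul0r.
exists (maxn N (maxn a b).+1) => n; rewrite geq_max gtn_max => /and3P[Nn an bn].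
rewrite pbwD pbw_mono.
have -> : E ^+ a * iota h * F ^+ b =
    \sum_(i < n) \sum_(j < n) E ^+ i * iota (mono a b h i j) * F ^+ j.
  rewrite (bigD1 (Ordinal an)) //= (bigD1 (Ordinal bn)) //= /mono !eqxx /=.
  rewrite !big1 ?addr0 // => [i|j].
    rewrite -val_eqE /= => /negPf ia; rewrite big1 // => j _.
    by rewrite ia iota0 mulr0 mul0r.
  by rewrite -val_eqE /= => /negPf ->; rewrite iota0 mulr0 mul0r.
rewrite {1}(IH n Nn) -big_split; apply: eq_bigr => i _.
rewrite -big_split; apply: eq_bigr => j _ /=.
by rewrite -mulrDl -mulrDr -iotaD.
Qed.

Lemma pbw_inj0 u : (forall i j, pbw u i j = 0) -> u = 0.
Proof.
move=> u0; have [N /(_ N (leqnn N)) ->] := pbw_expansion u.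
rewrite big1 // => i _; rewrite big1 // => j _.
by rewrite u0 iota0 mulr0 mul0r.
Qed.

(** On coefficients, left multiplication by E is an injective shift of i. *)
Lemma E_lreg x y : E * x = E * y -> x = y.
Proof.
move=> e; apply/eqP; rewrite -subr_eq0; apply/eqP/pbw_inj0 => i j.
have : pbw (E * (x - y)) i.+1 j = 0 by rewrite mulrBr e subrr /pbw pact0.
by rewrite /pbw pactM pact_gen.
Qed.

Definition shiftr (m : M) : M := fun i j => if j is j'.+1 then m i j' else 0.

(** The action of U is by left multiplications, which commute with right
multiplication by F, that is with the shift of j. *)
Lemma pact_shiftr u m : pact u (shiftr m) = shiftr (pact u m).
Proof.
elim/(presalg_ind (P := Uq_pres q)): u m => [g|c|x y IHx IHy|x y IHx IHy] m.
- rewrite !pact_gen; apply/funext => i; apply/funext => -[|j].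
    by case: g; rewrite /= ?mulr0 ?scaler0 ?oppr0 ?addr0 //; case: i.
  case: g => //=; congr (_ + _); case: j => //=; exact: sigma2_0.
- by rewrite !pact_scal; apply/funext => i; apply/funext => -[|j] //; apply: scaler0.
- rewrite !pactDl IHx IHy; apply/funext => i; apply/funext => -[|j] //.
  exact: addr0.
- by rewrite !pactM IHy IHx.
Qed.

Lemma F_rreg x y : x * F = y * F -> x = y.
Proof.
move=> e; apply/eqP; rewrite -subr_eq0; apply/eqP/pbw_inj0 => i j.
have : pbw ((x - y) * F) i j.+1 = 0 by rewrite mulrBl e subrr /pbw pact0.
rewrite /pbw pactM pact_F_mono sigma2_1.
have -> : mono 0 1 1 = shiftr (mono 0 0 1).
  by apply/funext => a; apply/funext => -[|b]; rewrite /mono //= andbF.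
by rewrite pact_shiftr.
Qed.

(** * The grading by deg E = 1, deg F = -1 *)

(** With s = 1 a bound d below on the degrees i - j, with s = -1 a bound -d above;
the integer s serves to treat both cases at once. *)
Definition supp (s d : int) (m : M) :=
  forall i j : nat, s * (i%:Z - j%:Z) < d -> m i j = 0.

(** The degree of an element is defined through its action on all families, not
only through its own coefficients, which makes it multiplicative by
definition. *)
Definition deg_ge (s d : int) (u : Uq q) :=
  forall e m, supp s e m -> supp s (e + d) (pact u m).

Lemma deg_geD s d u v : deg_ge s d u -> deg_ge s d v -> deg_ge s d (u + v).
Proof.
move=> du dv e m me i j ij; rewrite pactDl -[LHS]/(_ + _).
by rewrite (du e) // (dv e) // addr0.
Qed.

Lemma deg_geN s d u : deg_ge s d u -> deg_ge s d (- u).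
Proof.
by move=> du e m me i j ij; rewrite pactN -[LHS]/(- _) (du e) // oppr0.
Qed.

Lemma deg_geM s d d' u v :
  deg_ge s d u -> deg_ge s d' v -> deg_ge s (d + d') (u * v).
Proof. by move=> du dv e m me; rewrite pactM addrCA addrC; apply/du/dv. Qed.

Lemma deg_ge0 s d : deg_ge s d 0.
Proof. by move=> e m _ i j _; rewrite pact0. Qed.

Lemma deg_ge_scal s c : deg_ge s 0 c%:A.
Proof.
move=> e m me i j; rewrite addr0 pact_scal => ij.
by rewrite -[LHS]/(c *: _) me // scaler0.
Qed.

Lemma deg_geW s d d' u : d' <= d -> deg_ge s d u -> deg_ge s d' u.
Proof. by move=> dd du e m me i j ij; apply: (du e) => //; lia. Qed.

Lemma deg_ge_E s : deg_ge s s E.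
Proof.
move=> e m me i j ij; rewrite pact_gen /=.
by case: i ij => // i ij; apply: me; nia.
Qed.

Lemma deg_ge_F s : deg_ge s (- s) F.
Proof.
move=> e m me i j ij; rewrite pact_gen /=.
rewrite me ?mulr0 ?oppr0 ?add0r; last by nia.
by case: j ij => // j ij; rewrite me ?sigma2_0 //; nia.
Qed.

Lemma deg_ge_iota s h : deg_ge s 0 (iota h).
Proof.
elim/Uk_ind: h => [||c|x y IHx IHy|x y IHx IHy].
- rewrite iotaK // => e m me i j; rewrite addr0 pact_gen /= => ij.
  by rewrite me // mulr0 scaler0.
- rewrite iotaK' // => e m me i j; rewrite addr0 pact_gen /= => ij.
  by rewrite me // mulr0 scaler0.
- by rewrite iota_scal //; apply: deg_ge_scal.
- by rewrite iotaD //; apply: deg_geD.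
- by rewrite iotaM // -[X in deg_ge s X]addr0; apply: deg_geM.
Qed.

Lemma deg_ge_K s : deg_ge s 0 K.
Proof. by rewrite -(iotaK q); apply: deg_ge_iota. Qed.

Lemma deg_geX s d u n : deg_ge s d u -> deg_ge s (d * n%:Z) (u ^+ n).
Proof.
move=> du; elim: n => [|n IHn].
  by rewrite mulr0 expr0 -(scale1r 1); apply: deg_ge_scal.
by rewrite exprS intS mulrDr mulr1; apply: deg_geM.
Qed.

Lemma deg_ge_mono s i h l :
  deg_ge s (s * (i%:Z - l%:Z)) (E ^+ i * iota h * F ^+ l).
Proof.
have -> : s * (i%:Z - l%:Z) = s * i%:Z + 0 + - s * l%:Z by lia.
apply: deg_geM; first apply: deg_geM.
- exact/deg_geX/deg_ge_E.
- exact: deg_ge_iota.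
- exact/deg_geX/deg_ge_F.
Qed.

Lemma deg_disjoint d d' u : 0 < d + d' ->
  deg_ge 1 d u -> deg_ge (-1) d' u -> u = 0.
Proof.
move=> dd' du du'; apply: pbw_inj0 => i j.
have m0 s : supp s 0 (mono 0 0 1).
  move=> [|a] [|b] //; rewrite /mono ?andbF //=; lia.
have [ij|ij] := boolP (i%:Z - j%:Z < d).
  by apply: (du 0) => //; lia.
by apply: (du' 0) => //; lia.
Qed.

Lemma deg_comm s d d' u x : deg_ge s d u -> deg_ge s d' x ->
  deg_ge s (d + d') (u * x - x * u).
Proof.
move=> du dx; apply: deg_geD; first exact: deg_geM.
by apply: deg_geN; rewrite addrC; apply: deg_geM.
Qed.

(** The two commutators add up to 0, but the first one has degrees at least d and
the second one at most d - 1. *)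
Lemma comm_summands u v x d : central (u + v) ->
  deg_ge 1 0 u -> deg_ge (-1) 1 v -> deg_ge 1 d x -> deg_ge (-1) (- d) x ->
  u * x = x * u /\ v * x = x * v.
Proof.
move=> uv du dv dx dx'.
have e : u * x - x * u = - (v * x - x * v).
  apply/eqP; rewrite -addr_eq0 addrACA -opprD -mulrDl -mulrDr uv.
  by rewrite subrr.
have ux : u * x - x * u = 0.
  apply: (@deg_disjoint (0 + d) (1 - d)); first lia.
    exact: deg_comm.
  by rewrite e; apply/deg_geN/deg_comm.
split; apply/eqP; rewrite -subr_eq0; first by rewrite ux.
by rewrite -oppr_eq0 -e ux.
Qed.

(** A monomial E^i h F^l belongs to E b when i >= l and i > 0, and to c F when
i < l; when i = l = 0 it is its own projection to C[K, K^-1]. *)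
Lemma triangular_split u : exists h b c,
  [/\ u = iota h + E * b + c * F, deg_ge 1 0 (iota h + E * b)
    & deg_ge (-1) 1 (c * F)].
Proof.
elim: (ordered_all q0 u) => [|i h l v _ [h' [b [c [-> db dc]]]]].
  exists 0, 0, 0; rewrite iota0 mulr0 mul0r !addr0.
  by split=> //; apply: deg_ge0.
have dm s := @deg_ge_mono s i h l.
case: (leqP l i) => il; last first.
  case: l il dm => // l il dm.
  exists h', b, (E ^+ i * iota h * F ^+ l + c).
  have -> : (E ^+ i * iota h * F ^+ l + c) * F =
      E ^+ i * iota h * F ^+ l.+1 + c * F by rewrite mulrDl exprSr !mulrA.
  split=> //; first by rewrite addrCA.
  by apply: deg_geD => //; apply: deg_geW (dm (-1)); lia.
case: i il dm => [|i] il dm.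
  move: il dm; rewrite leqn0 => /eqP -> dm.
  rewrite !expr0 mul1r mulr1 in dm *.
  exists (h + h'), b, c; rewrite iotaD // -!addrA; split=> //.
  by apply: deg_geD; [apply: deg_ge_iota | ].
exists h', (E ^+ i * iota h * F ^+ l + b), c.
have -> : E * (E ^+ i * iota h * F ^+ l + b) =
    E ^+ i.+1 * iota h * F ^+ l + E * b by rewrite mulrDr exprS !mulrA.
rewrite [iota h' + (_ + _)]addrCA -!addrA; split=> //.
by apply: deg_geD => //; apply: deg_geW (dm 1); lia.
Qed.

(** The second and third equations are u E = E u and F v = v F after cancellation,
for u = iota (mu z) + E b and v = c F; adding them gives the second expression
of z. *)
Lemma central_decomposition z : central z -> exists b c,
  [/\ z = iota (mu z) + E * b + c * F,
      iota (mu z) + E * b = iota (sigma2 (mu z)) + b * E,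
      c * F = F * c,
      K * b = q ^- 2 *: (b * K) & K * c = q ^+ 2 *: (c * K)].
Proof.
move=> zc; have [h [b [c [ze du dv]]]] := triangular_split z.
exists b, c; rewrite (mu_eq q0 ze).
have zc' := zc; rewrite {1}ze in zc'.
have [uE _] := comm_summands zc' du dv (@deg_ge_E 1) (@deg_ge_E (-1)).
have dF : deg_ge (-1) (- -1) F by exact: deg_ge_F.
have [_ vF] := comm_summands zc' du dv (@deg_ge_F 1) dF.
have [uK vK] := comm_summands zc' du dv (@deg_ge_K 1) (@deg_ge_K (-1)).
split=> //.
- by apply: E_lreg; rewrite -uE mulrDl mulrDr iota_E !mulrA.
- by apply: F_rreg; rewrite vF mulrA.
- apply: E_lreg; move: uK; rewrite mulrDl mulrDr -(iotaK q) -!iotaM // Uk_comm.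
  move/addrI; rewrite iotaK // => e.
  rewrite -scalerAr (mulrA E b) e (mulrA K) KE -scalerAl scalerA.
  by rewrite mulVf ?expf_neq0 // scale1r mulrA.
- apply: F_rreg; rewrite -scalerAl -!mulrA KF -!scalerAr scalerA.
  rewrite mulfV ?expf_neq0 // scale1r.
  by rewrite (mulrA c) vK.
Qed.

(** * The Dirac operator *)

Lemma deltaD : {morph delta q : x y / x + y}.
Proof. exact: (Uk_liftD (deltaKK' q0) (deltaK'K q0)). Qed.

Lemma deltaM : {morph delta q : x y / x * y}.
Proof. exact: (Uk_liftM (deltaKK' q0) (deltaK'K q0)). Qed.

Lemma delta_scal c : delta q c%:A = c%:A.
Proof. exact: (Uk_lift_scal (deltaKK' q0) (deltaK'K q0)). Qed.

Lemma deltaZ c x : delta q (c *: x) = c *: delta q x.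
Proof. by rewrite -mulr_algl deltaM delta_scal mulr_algl. Qed.

Lemma cEFE : cE * cF * cE = cE.
Proof. by rewrite -[RHS]mulr1 -cEF mulrDr !mulrA cEE mul0r add0r. Qed.

Lemma cFEF : cF * cE * cF = cF.
Proof. by rewrite -[RHS]mul1r -cEF mulrDl -[cE * cF * cF]mulrA cFF mulr0 add0r. Qed.

Lemma tens0r (x : Uq q) : x \ox (0 : Cl k) = 0.
Proof. by rewrite -(scale0r 0) tensZr scale0r. Qed.

(** cE cF and cF cE are the complementary diagonal idempotents of C(p), cE and cF
the off-diagonal units: [diag] and [antidiag] below are the diagonal and the
off-diagonal 2 x 2 matrices over U. *)
Definition diag (x y : Uq q) : UqCl q := x \ox (cE * cF) + y \ox (cF * cE).

Lemma diagD x x' y y' : diag (x + x') (y + y') = diag x y + diag x' y'.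
Proof. by rewrite /diag !tensDl addrACA. Qed.

Lemma diagZ c x y : diag (c *: x) (c *: y) = c *: diag x y.
Proof. by rewrite /diag !tensZl scalerDr. Qed.

Lemma diagM x x' y y' : diag (x * x') (y * y') = diag x y * diag x' y'.
Proof.
rewrite /diag mulrDl !mulrDr !tensM !mulrA cEFE cFEF.
rewrite -[cE * cF * cF]mulrA cFF -[cF * cE * cE]mulrA cEE.
by rewrite !(mulr0, mul0r) !tens0r addr0 add0r.
Qed.

Lemma diag_tens1 x : diag x x = x \ox 1.
Proof. by rewrite /diag -tensDr cEF. Qed.

(** alpha(K) has the diagonal entries q and q^-1, and sigma contributes a further
factor q. *)
Lemma delta_sigma h : delta q (sigma h) = diag (iota (sigma2 h)) (iota h).
Proof.
elim/Uk_ind: h => [||c|x y IHx IHy|x y IHx IHy].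
- rewrite (sigmaK q0) deltaZ (deltaK q0) (alphaK q0) sigma2K iotaZ // iotaK //.
  rewrite -cEF tensDr !tensZr tensDr /diag tensZl.
  move: (K \ox (cE * cF)) (K \ox (cF * cE)) => X Y.
  rewrite scalerDr !scalerA mulfV // scale1r mulrBr mulfV // scalerBl scale1r.
  by rewrite addrAC [X + _]addrC subrK.
- rewrite (sigmaK' q0) deltaZ (deltaK' q0) (alphaK' q0) sigma2K' iotaZ // iotaK' //.
  rewrite -cEF tensDr -scaleNr !tensZr tensDr /diag tensZl.
  move: (K' \ox (cE * cF)) (K' \ox (cF * cE)) => X Y.
  rewrite opprB scalerDr !scalerA mulVf // scale1r mulrBr mulVf // scalerBl.
  by rewrite scale1r addrAC [X + _]addrC subrK -invfM.
- by rewrite sigma_scal delta_scal sigma2_scal !iota_scal // diag_tens1 tensZl.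
- by rewrite sigmaD deltaD IHx IHy sigma2D !iotaD // diagD.
- by rewrite sigmaM deltaM IHx IHy sigma2M !iotaM // diagM.
Qed.

Lemma delta_K0 : delta q K0 = diag (q *: K) (q^-1 *: K).
Proof.
have e : delta q K0 = q^-1 *: delta q (sigma K0).
  by rewrite (sigmaK q0) deltaZ scalerA mulVf // scale1r.
rewrite e delta_sigma -diagZ sigma2K iotaZ // iotaK // scalerA expr2 mulrA.
by rewrite mulVf // mul1r.
Qed.

Definition antidiag (b c : Uq q) : UqCl q := b \ox cE + c \ox cF.

Lemma diag_antidiag x y b c : diag x y * antidiag b c = antidiag (x * b) (y * c).
Proof.
rewrite /diag /antidiag mulrDl !mulrDr !tensM cEFE cFEF.
rewrite -[cE * cF * cF]mulrA -[cF * cE * cE]mulrA cEE cFF.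
by rewrite !mulr0 !tens0r addr0 add0r.
Qed.

Lemma antidiag_diag x y b c : antidiag b c * diag x y = antidiag (b * y) (c * x).
Proof.
rewrite /diag /antidiag mulrDl !mulrDr !tensM !mulrA cEFE cFEF cEE cFF.
by rewrite !mul0r !tens0r addr0 add0r.
Qed.

Lemma antidiagM b c b' c' : antidiag b c * antidiag b' c' = diag (b * c') (c * b').
Proof.
rewrite /antidiag /diag mulrDl !mulrDr !tensM cEE cFF.
by rewrite !tens0r addr0 add0r.
Qed.

Lemma diracE : dirac q = antidiag F E.
Proof. exact: addrC. Qed.

(** The entries of delta(K) being q K and q^-1 K, conjugation by it turns b into
q^2 K b K^-1 and c into q^-2 K c K^-1. *)
Lemma antidiag_invariant b c :
  K * b = q ^- 2 *: (b * K) -> K * c = q ^+ 2 *: (c * K) ->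
  Uk_invariant (antidiag b c).
Proof.
move=> Kb Kc.
have dc : delta q K0 * antidiag b c = antidiag b c * delta q K0.
  rewrite delta_K0 diag_antidiag antidiag_diag -!scalerAl -!scalerAr Kb Kc !scalerA.
  by rewrite expr2 invfM !mulrA mulfV // mulVf // !mul1r.
have [dd' d'd] := (deltaKK' q0, deltaK'K q0).
rewrite -(deltaK q0) -(deltaK' q0) in dd' d'd.
by split; [rewrite dc -mulrA dd' mulr1|rewrite -mulrA -dc mulrA d'd mul1r].
Qed.

Theorem central_dirac_cohomologous (z : Uq q) : central z ->
  exists a : UqCl q,
    Uk_invariant a /\ z \ox 1 = zeta z + dirac q * a + a * dirac q.
Proof.
move=> /central_decomposition[b [c [ze uE vF Kb Kc]]].
exists (antidiag b c); split; first exact: antidiag_invariant.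
rewrite /zeta /gamma delta_sigma diracE !antidiagM -!diagD -diag_tens1; congr diag.
  by rewrite {1}ze uE vF addrAC.
exact: ze.
Qed.

End Quantum.

Theorem theorem2p23 (R : realType) (q : R[i]) (q_neq0 : q != 0) (q_neq1 : q != 1)
    (q_neqN1 : q != -1) (z : Uq q) (z_central : central z) :
  exists a : UqCl q,
    Uk_invariant a /\ z \ox 1 = zeta z + dirac q * a + a * dirac q.
Proof. exact: central_dirac_cohomologous. Qed.
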